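(* Let $\omega:\mathbb{R}^+\to\mathbb{R}^+$ be a function such that $\omega(t)/t$ is increasing and $\sum_{n\ge1}\frac{1}{\omega(n)}<\infty$. Let $\sum_{n=-\infty}^{\infty}c(n)e^{int}$ be a trigonometric series whose symmetric partial sums converge to $0$ for almost every $t\in\mathbb{T}$, and suppose that $c(n)=O\big(e^{-\omega(\log|n|)}\big)$ for $n<0$. Then $c(n)=0$ for all $n\in\mathbb{Z}$.
   Context: $\mathbb{T}=\mathbb{R}/2\pi\mathbb{Z}$; symmetric partial sums are $\sum_{|n|\le N}c(n)e^{int}$. *)

(* Defs.v *)
From mathcomp Require Import all_boot all_order all_algebra complex.
From mathcomp Require Import all_classical all_reals all_analysis.
Set Implicit Arguments. Unset Strict Implicit. Unset Printing Implicit Defensive.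
Import numFieldNormedType.Exports.
Import Order.TTheory GRing.Theory Num.Theory.
Local Open Scope ring_scope.
Local Open Scope complex_scope.

Definition expi (R : realType) (x : R) : R[i] := Complex (cos x) (sin x).

(* symmetric partial sum  \sum_{|n| <= N} c(n) e^{int},
   indexed by k = 0..2N, n = k - N *)
Definition sym_partial_sum (R : realType) (c : int -> R[i]) (N : nat) (t : R) : R[i] :=
  \sum_(k < (N.*2).+1)
     c (k%:Z - N%:Z) * expi ((k%:Z - N%:Z)%:~R * t).

Definition sym_sums_to_zero (R : realType) (c : int -> R[i]) (t : R) : Prop :=
  forall eps : R, 0 < eps ->
    exists N0 : nat, forall N : nat, (N0 <= N)%N -> `|sym_partial_sum c N t| < eps%:C.

(* Main.v *)
Require Import Defs.
From mathcomp Require Import all_boot all_order all_algebra complex.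
From mathcomp Require Import all_classical all_reals all_analysis.
From mathcomp Require Import measurable_realfun.
From mathcomp Require Import ring lra zify.
Import numFieldNormedType.Exports.
Import Order.TTheory GRing.Theory Num.Theory.
Local Open Scope ring_scope.
Local Open Scope complex_scope.
Local Notation normc := ComplexField.Normc.normc.
Set Implicit Arguments.
Unset Strict Implicit.
Unset Printing Implicit Defensive.

(**
Let [M_k = 4 ^ (2 ^ k)], [r_k = 1 - 1 / M_(k+1)] and let [b_k] be (essentially)
[omega (2 ^ k) / 2 ^ k], so that [sum 1 / b_k] converges.  Consider the polynomials
[H_k (z) = sum_(- M_k <= n <= L) c (n) z ^ (n + M_k)], with [L] huge.  On the unit circle
the full series is [0] almost everywhere, so there [H_k] is of the size of the omitted
negative coefficients, at most [exp (- 4 gam_k)] with [gam_k = b_k 2 ^ k / 16].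

1. Good points.  By Egorov's theorem and Abel summation, [H_k] is bounded on the union of
the Stolz angles over a set of almost full measure, and tiny near that set.  The maximum
principle for [ln |H_k|], with the Poisson integral of the complement as barrier, gives
[|H_k| <= exp (- gam_k)] on most of the circle [|z| = r_k].

2. If [|H_k0 (z0)| > e] for some [|z0| = r_k0], let unit mass flow from [z0] along the
circles [|z| = r_k] by Poisson kernels and discard it when it reaches a point where
[|H_(k+1)| <= exp (- gam_k)].  Since [ln |H_k|] is subharmonic and [H_k] nearly agrees with
[H_(k+1)] at undiscarded points, the integral of [ln |H_k|] against the remaining mass [q_k]
stays positive, although it is at most [O (2 ^ k) q_k] and every discarded unit costs
[gam_k].  So the proportion discarded at step [k] is [O (1 / b_k)], a convergent sum, and
[q_k >= 1 / 2] for all [k].  This contradicts step 1.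

3. Hence [|H_k| <= e] on [|z| = r_k], and [H_k] is tiny on most of that circle; so its mean
against each character is small, and all coefficients vanish.

All means are taken over finite grids of equally spaced points.
*)

(** * Complex modulus *)

Section ComplexModulus.
Variable R : realType.
Implicit Types z w : R[i].

Lemma normcE z : `|z| = (normc z)%:C.
Proof. by []. Qed.

Lemma ltr_normcE z (e : R) : (`|z| < e%:C) = (normc z < e).
Proof. by rewrite normcE ltcR. Qed.

Lemma ler_normcE z (e : R) : (`|z| <= e%:C) = (normc z <= e).
Proof. by rewrite normcE lecR. Qed.

Lemma normc_ge0 z : 0 <= normc z.
Proof. by case: z => a b; exact: sqrtr_ge0. Qed.

Lemma normcM z w : normc (z * w) = normc z * normc w.
Proof. exact: ComplexField.Normc.normcM. Qed.

Lemma normcV z : normc z^-1 = (normc z)^-1.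
Proof. exact: ComplexField.Normc.normcV. Qed.

Lemma normc0 : normc (0 : R[i]) = 0.
Proof. exact: ComplexField.Normc.normc0. Qed.

Lemma normc1 : normc (1 : R[i]) = 1.
Proof. exact: ComplexField.Normc.normc1. Qed.

Lemma normcN z : normc (- z) = normc z.
Proof. exact: complex.normcN. Qed.

Lemma normcX z n : normc (z ^+ n) = normc z ^+ n.
Proof. by elim: n => [|n IH]; rewrite ?expr0 ?normc1// !exprS normcM IH. Qed.

Lemma ler_normcD z w : normc (z + w) <= normc z + normc w.
Proof. exact: complex.le_normcD. Qed.

Lemma ler_normcB z w : normc (z - w) <= normc z + normc w.
Proof. by rewrite -(normcN w); exact: ler_normcD. Qed.

Lemma normcBC z w : normc (z - w) = normc (w - z).
Proof. by rewrite -normcN opprB. Qed.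

Lemma lerB_normc z w : normc z - normc w <= normc (z - w).
Proof. by rewrite lerBlDr -{1}(subrK w z) ler_normcD. Qed.

Lemma normc_eq0 z : (normc z == 0) = (z == 0).
Proof.
apply/eqP/eqP => [|->]; last exact: normc0.
exact: ComplexField.Normc.eq0_normc.
Qed.

Lemma normc_gt0 z : (0 < normc z) = (z != 0).
Proof. by rewrite lt_neqAle normc_ge0 andbT eq_sym normc_eq0. Qed.

Lemma normc_real (x : R) : 0 <= x -> normc x%:C = x.
Proof. by move=> x0; rewrite /= expr0n/= addr0 sqrtr_sqr ger0_norm. Qed.

Lemma normc_sum (I : Type) (r : seq I) (P : pred I) (F : I -> R[i]) :
  normc (\sum_(i <- r | P i) F i) <= \sum_(i <- r | P i) normc (F i).
Proof.
elim/big_ind2: _ => [|x1 x2 y1 y2 h1 h2|//]; first by rewrite normc0.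
by rewrite (le_trans (ler_normcD _ _))// lerD.
Qed.

Lemma normc_sqr z : normc z ^+ 2 = complex.Re z ^+ 2 + complex.Im z ^+ 2.
Proof. by case: z => a b /=; rewrite sqr_sqrtr// addr_ge0// sqr_ge0. Qed.

Lemma ler_Re_normc z : complex.Re z <= normc z.
Proof.
rewrite -[leRHS]ger0_norm ?normc_ge0// -sqrtr_sqr normc_sqr.
case: z => a b /=; rewrite (le_trans (ler_norm a))// -sqrtr_sqr.
by rewrite ler_sqrt ?addr_ge0 ?sqr_ge0// lerDl sqr_ge0.
Qed.

Lemma ler_normRe_normc z : `|complex.Re z| <= normc z.
Proof.
rewrite ler_norml ler_Re_normc andbT lerNl -(normcN z).
by apply: le_trans (ler_Re_normc _); case: z.
Qed.

Lemma ReD z w : complex.Re (z + w) = complex.Re z + complex.Re w.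
Proof. by case: z; case: w. Qed.
Lemma ImD z w : complex.Im (z + w) = complex.Im z + complex.Im w.
Proof. by case: z; case: w. Qed.
Lemma ReN z : complex.Re (- z) = - complex.Re z.
Proof. by case: z. Qed.

Lemma Re_sum (I : Type) (r : seq I) (P : pred I) (F : I -> R[i]) :
  complex.Re (\sum_(i <- r | P i) F i) = \sum_(i <- r | P i) complex.Re (F i).
Proof. by elim/big_ind2: _ => [//|x1 x2 y1 y2 <- <-|//]; rewrite ReD. Qed.

Lemma Re_realM (x : R) z : complex.Re (x%:C * z) = x * complex.Re z.
Proof. by case: z => a b /=; rewrite mul0r subr0. Qed.

Lemma expiD (x y : R) : expi (x + y) = expi x * expi y.
Proof.
rewrite /expi cosD sinD; congr Complex => //.
by rewrite [RHS]addrC; congr (_ + _); rewrite mulrC.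
Qed.

Lemma expi0 : expi (0 : R) = 1.
Proof. by rewrite /expi cos0 sin0. Qed.

Lemma expiM_nat (x : R) n : expi (n%:R * x) = expi x ^+ n.
Proof.
elim: n => [|n IH]; first by rewrite mul0r expi0 expr0.
by rewrite -natr1 mulrDl mul1r expiD IH exprSr.
Qed.

Lemma normc_expi (x : R) : normc (expi x) = 1.
Proof. by rewrite /= cos2Dsin2 sqrtr1. Qed.

Lemma expi_neq0 (x : R) : expi x != 0.
Proof. by rewrite -normc_gt0 normc_expi. Qed.

End ComplexModulus.

(** * Poisson kernel on a grid *)

Section Grid.
Variable R : realType.
Implicit Types z w xi : R[i].

Definition poisson z xi : R := (1 - normc z ^+ 2) / normc (xi - z) ^+ 2.

(** The rotation [th] stays free, because the points where the partial sums behave well fill most of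
    the grid only for a suitable rotation. *)
Definition grid (th : R) (N l : nat) : R[i] := expi (th + l%:R * (2 * pi / N%:R)).

Lemma poisson_ge0 z xi : normc z <= 1 -> 0 <= poisson z xi.
Proof.
move=> z1; by rewrite divr_ge0 ?sqr_ge0// subr_ge0 expr_le1 ?normc_ge0.
Qed.

(** The kernel is the real part of [(xi + z) / (xi - z)], written with a single occurrence of [z],
    so that sums over grid points or over shifts of [z] become sums of simple fractions. *)
Lemma poissonE z xi : normc xi = 1 -> xi != z ->
  poisson z xi = complex.Re (2 * xi / (xi - z)) - 1.
Proof.
move=> xi1 xiz; have {xiz} : normc (xi - z) ^+ 2 != 0.
  by rewrite expf_eq0/= normc_eq0 subr_eq0.
have : normc xi ^+ 2 = 1 by rewrite xi1 expr1n.
have -> : 2 * xi / (xi - z) = (2 : R)%:C * (xi / (xi - z)) by rewrite rmorph_nat mulrA.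
rewrite Re_realM.
rewrite /poisson !normc_sqr; case: xi {xi1} => a b; case: z => x y /= xi1 xiz.
move: xiz; set d := _ + _ => d0.
have -> : 1 - (x ^+ 2 + y ^+ 2) = 2 * (a * (a - x) + b * (b - y)) - d.
  transitivity ((a ^+ 2 + b ^+ 2) - (x ^+ 2 + y ^+ 2)); first by rewrite xi1.
  by rewrite /d; ring.
by field.
Qed.

Lemma normc_grid th N l : normc (grid th N l) = 1.
Proof. exact: normc_expi. Qed.

Lemma grid_neq0 th N l : grid th N l != 0.
Proof. exact: expi_neq0. Qed.

Lemma gridE th N l : grid th N l = expi th * expi (2 * pi / N%:R) ^+ l.
Proof. by rewrite /grid expiD expiM_nat. Qed.

Lemma grid_rootX N : (0 < N)%N -> expi (2 * pi / N%:R : R) ^+ N = 1.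
Proof.
move=> N0; rewrite -expiM_nat mulrC divfK ?pnatr_eq0 -?lt0n//.
by rewrite /expi mulr_natl cos2pi sin2pi.
Qed.

Lemma gridX th N l : (0 < N)%N -> grid th N l ^+ N = expi th ^+ N.
Proof. by move=> N0; rewrite gridE exprMn exprAC grid_rootX// expr1n mulr1. Qed.

Lemma grid_root_prim N n : (0 < n < N)%N -> expi (2 * pi / N%:R : R) ^+ n != 1.
Proof.
move=> /andP[n0 nN]; have N0 : (0 < N)%N := leq_trans n0 (ltnW nN).
rewrite -expiM_nat eq_complex/= negb_and; apply/orP; left.
have -> : n%:R * (2 * pi / N%:R) = (n%:R * pi / N%:R) *+ 2 :> R.
  by rewrite mulr2n; field; rewrite pnatr_eq0 -lt0n.
(* For [x = n * pi / N], strictly between [0] and [pi], [cos (2 * x) = 1 - 2 * sin x ^ 2 < 1]. *)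
rewrite cos_mulr2n.
suff : 0 < sin (n%:R * pi / N%:R : R).
  by move=> s0; rewrite cos2sin2; apply/eqP; move: (exprn_gt0 2 s0) => ?; lra.
apply: sin_gt0_pi; rewrite ?divr_gt0 ?mulr_gt0 ?pi_gt0 ?ltr0n//.
by rewrite ltr_pdivrMr ?ltr0n// mulrC ltr_pM2l ?pi_gt0// ltr_nat.
Qed.

Lemma sum_gridX th N n : (0 < n < N)%N -> \sum_(l < N) grid th N l ^+ n = 0.
Proof.
move=> nN; have N0 : (0 < N)%N by case/andP: nN => /leq_trans + /ltnW; apply.
under eq_bigr do rewrite gridE exprMn exprAC.
rewrite -mulr_sumr; apply/eqP; rewrite mulf_eq0; apply/orP; right.
have h := subrX1 (expi (2 * pi / N%:R : R) ^+ n) N.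
move: h; rewrite exprAC grid_rootX// expr1n subrr => /esym/eqP.
by rewrite mulf_eq0 subr_eq0 (negPf (grid_root_prim nN)).
Qed.

Lemma sum_gridV th N n : (0 < n < N)%N -> \sum_(l < N) (grid th N l ^+ n)^-1 = 0.
Proof.
move=> nN; have /andP[n0 nN'] := nN.
have N0 : (0 < N)%N by exact: leq_ltn_trans nN'.
(* [grid th N l ^+ N] is the same for all [l], so inverse powers [n] are powers [N - n] up to a
   common factor. *)
transitivity ((\sum_(l < N) grid th N l ^+ (N - n)) * (expi th ^+ N)^-1); last first.
  by rewrite sum_gridX ?mul0r//; lia.
rewrite mulr_suml; apply: eq_bigr => l _.
rewrite -(gridX th l N0).
have -> : grid th N l ^+ N = grid th N l ^+ (N - n) * grid th N l ^+ n.
  by rewrite -exprD subnK// ltnW.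
by rewrite invfM mulrA divff ?mul1r// expf_neq0// grid_neq0.
Qed.

(* Expand [1 / (1 - w)] with [w = z / xi] as a geometric polynomial over
   [1 - w ^ N]; [w ^ N] is the same at all grid points. *)
Lemma poisson_mean z th N : (0 < N)%N -> normc z < 1 ->
  (\sum_(l < N) poisson z (grid th N l)) / N%:R =
  complex.Re (2 / (1 - (z / expi th) ^+ N)) - 1.
Proof.
move=> N0 z1; set v := (z / expi th) ^+ N.
have v1 : normc v < 1.
  by rewrite normcX normcM normcV normc_expi invr1 mulr1 exprn_ilt1 ?normc_ge0// -lt0n.
have nv : 1 - v != 0.
  by rewrite subr_eq0; apply: contraTneq v1 => <-; rewrite normc1 ltxx.
have gz l : grid th N l != z.
  by apply: contraTneq z1 => <-; rewrite normc_grid ltxx.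
under eq_bigr do rewrite poissonE ?normc_grid//.
rewrite big_split/= sumrN sumr_const card_ord mulrBl divff ?pnatr_eq0 -?lt0n//.
congr (_ - _); rewrite -Re_sum.
have -> : \sum_(l < N) 2 * grid th N l / (grid th N l - z) = (N%:R : R)%:C * (2 / (1 - v)).
  rewrite [RHS]mulrA; apply: (mulIf nv); rewrite divfK// mulr_suml.
  transitivity (\sum_(l < N) \sum_(n < N) 2 * (z ^+ n * (grid th N l ^+ n)^-1)).
    apply: eq_bigr => l _.
    have gz0 : grid th N l - z != 0 by rewrite subr_eq0.
    have -> : v = (z / grid th N l) ^+ N.
      by rewrite /v !exprMn !exprVn gridX.
    rewrite -mulr_sumr -!mulrA; congr (_ * _); rewrite mulrA.
    rewrite -[1 - _]opprB subrX1.
    under [in RHS]eq_bigr do rewrite -exprVn -exprMn.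
    rewrite -mulNr opprB mulrA.
    have -> : grid th N l / (grid th N l - z) * (1 - z / grid th N l) = 1.
      by field; rewrite gz0 grid_neq0.
    by rewrite mul1r.
  rewrite exchange_big/= (bigD1 (Ordinal N0))//= [X in _ + X]big1 ?addr0.
    under eq_bigr do rewrite !expr0 invr1 !mulr1.
    by rewrite sumr_const card_ord rmorph_nat mulr_natl.
  move=> n n0; rewrite -mulr_sumr -mulr_sumr sum_gridV ?mulr0// ltn_ord andbT.
  by rewrite lt0n; apply: contraNneq n0 => h; apply/eqP/val_inj.
by rewrite Re_realM mulrAC divff ?mul1r// pnatr_eq0 -lt0n.
Qed.

(** By [poisson_mean] the deviation from [1] is the real part of [2 * v / (1 - v)], where
    [v = (z / expi th) ^+ N] has modulus at most [a ^+ N]. *)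
Lemma poisson_mean_near z th N a : (0 < N)%N -> normc z <= a -> a < 1 ->
  `|(\sum_(l < N) poisson z (grid th N l)) / N%:R - 1| <= 2 * a ^+ N / (1 - a ^+ N).
Proof.
move=> N0 za a1; have z1 : normc z < 1 by exact: le_lt_trans a1.
have a0 : 0 <= a by exact: le_trans (normc_ge0 z) za.
have aN : a ^+ N < 1 by rewrite exprn_ilt1 -?lt0n.
rewrite poisson_mean//; set v := (z / expi th) ^+ N.
have v1 : normc v <= a ^+ N.
  rewrite normcX normcM normcV normc_expi invr1 mulr1.
  by rewrite lerXn2r// ?nnegrE// normc_ge0.
have nv : 1 - v != 0.
  by rewrite subr_eq0; apply: contraTneq v1 => <-; rewrite normc1 -ltNge.
have -> : complex.Re (2 / (1 - v)) - 1 - 1 = complex.Re (2 * v / (1 - v)).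
  have -> : 2 * v / (1 - v) = 2 / (1 - v) - 1 - 1 by field.
  by rewrite !ReD !ReN.
apply: le_trans (ler_normRe_normc _) _.
rewrite !normcM normcV.
have -> : normc (2 : R[i]) = 2 by rewrite -(rmorph_nat (real_complex R)) normc_real.
have h : 1 - a ^+ N <= normc (1 - v).
  by apply: le_trans (lerB_normc _ _); rewrite normc1 lerB.
apply: ler_pM; rewrite ?mulr_ge0 ?invr_ge0 ?normc_ge0//.
  by rewrite ler_wpM2l.
by rewrite lef_pV2// ?posrE ?subr_gt0//; apply: lt_le_trans h; rewrite subr_gt0.
Qed.

(** Stands in for the identity that the Poisson kernel has mean [1] on the circle. One [N0] serves
    all rotations and the whole disc of radius [a]. *)
Lemma poisson_mean_cvg (a e : R) : 0 <= a < 1 -> 0 < e ->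
  exists N0 : nat, (0 < N0)%N /\ forall N th z, (N0 <= N)%N -> normc z <= a ->
  `|(\sum_(l < N) poisson z (grid th N l)) / N%:R - 1| <= e.
Proof.
move=> /andP[a0 a1] e0.
have [n an] : exists n, a ^+ n < e / (2 + e).
  have e2 : 0 < e / (2 + e) by apply: divr_gt0; lra.
  have /cvgrPdist_lt/(_ _ e2)[n _ h] : ((fun n => a ^+ n) @ \oo --> (0 : R))%classic.
    by apply: cvg_expr; rewrite ger0_norm.
  by exists n; have := h n (leqnn n); rewrite sub0r normrN ger0_norm ?exprn_ge0.
exists n.+1; split=> // N th z nN za.
have N0 : (0 < N)%N by exact: leq_trans nN.
apply: le_trans (poisson_mean_near _ N0 za a1) _.
have aN : a ^+ N <= e / (2 + e).
  apply: le_trans (ltW an); apply: ler_wiXn2l => //; first exact: ltW.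
  exact: ltnW.
have e3 : e / (2 + e) < 1 by rewrite ltr_pdivrMr; lra.
rewrite ler_pdivrMr; last lra.
have : a ^+ N * (2 + e) <= e by rewrite -ler_pdivlMr//; lra.
by move: (a ^+ N) => x; lra.
Qed.

End Grid.

(** * Maximum principle *)

Section MaximumPrinciple.
Variable R : realType.
Implicit Types (z w xi : R[i]) (p : {poly R[i]}).
Local Notation "'i" := (Complex 0 1 : R[i]).

(** * Four-point means as a discrete substitute for the Laplacian *)

Lemma sum4_sqr_normc z (e : R) :
  normc (z + e%:C) ^+ 2 + normc (z - e%:C) ^+ 2
  + normc (z + 'i * e%:C) ^+ 2 + normc (z - 'i * e%:C) ^+ 2
  = 4 * normc z ^+ 2 + 4 * e ^+ 2.
Proof. by rewrite !normc_sqr; case: z => x y /=; ring. Qed.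

Lemma normcX4_ge w (e : R) : normc w ^+ 4 - e ^+ 4 <= normc (w ^+ 4 - e%:C ^+ 4).
Proof.
apply: le_trans (lerB_normc _ _); rewrite normcX lerB//.
rewrite -rmorphXn/= expr0n/= addr0 sqrtr_sqr ger0_norm//.
by rewrite exprn_even_ge0.
Qed.

Lemma horner4_ge p z : p.[z] != 0 -> exists2 C : R, 0 <= C &
  forall e, C * e ^+ 4 <= 1 ->
  (1 - C * e ^+ 4) * normc p.[z] ^+ 4 <=
  normc (p.[z + e%:C] * p.[z - e%:C] * p.[z + 'i * e%:C] * p.[z - 'i * e%:C]).
Proof.
have [rs ->] := closed_field_poly_normal p.
rewrite hornerZ mulf_eq0 negb_or => /andP[l0].
suff h : (\prod_(r <- rs) ('X - r%:P)).[z] != 0 -> exists2 C : R, 0 <= C &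
    forall e, C * e ^+ 4 <= 1 ->
    let q := \prod_(r <- rs) ('X - r%:P) in
    (1 - C * e ^+ 4) * normc q.[z] ^+ 4 <=
    normc (q.[z + e%:C] * q.[z - e%:C] * q.[z + 'i * e%:C] * q.[z - 'i * e%:C]).
  move=> /h[C C0 hC]; exists C => // e /hC /= {}hC.
  rewrite !hornerZ; set l := lead_coef p; set A := _.[z + _] in hC *.
  set B := _.[z - _] in hC *; set A' := _.[z + _] in hC *.
  set B' := _.[z - _] in hC *.
  have -> : l * A * (l * B) * (l * A') * (l * B') = l ^+ 4 * (A * B * A' * B').
    by ring.
  rewrite (normcM (l ^+ 4)) normcX (normcM l) exprMn mulrCA.
  by rewrite ler_wpM2l ?exprn_ge0 ?normc_ge0.
elim: rs => [|r rs IH].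
  move=> _; exists 0 => // e _ /=; rewrite big_nil !hornerC !mulr1 normc1.
  by rewrite mul0r subr0 mul1r expr1n.
rewrite big_cons hornerM hornerXsubC mulf_eq0 negb_or => /andP[zr /IH[C C0 hC]].
have zr0 : 0 < normc (z - r) by rewrite normc_gt0.
have zr4 : 0 < normc (z - r) ^+ 4 by rewrite exprn_gt0.
exists (C + (normc (z - r) ^+ 4)^-1); first by rewrite addr_ge0// ltW// invr_gt0.
move=> e; set D := (_ ^+ 4)^-1; rewrite mulrDl => he.
have D0 : 0 < D by rewrite invr_gt0.
have e0 : 0 <= e ^+ 4 by rewrite exprn_even_ge0.
have Ce0 : 0 <= C * e ^+ 4 by rewrite mulr_ge0.
have De0 : 0 <= D * e ^+ 4 by rewrite mulr_ge0// ltW.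
rewrite /= !hornerM !hornerXsubC.
have /hC /= {}hC : C * e ^+ 4 <= 1 by lra.
set A := _.[z + _] in hC *.
set B := _.[z - _] in hC *; set A' := _.[z + _] in hC *.
set B' := _.[z - _] in hC *.
have -> : (z + e%:C - r) * A * ((z - e%:C - r) * B) * ((z + 'i * e%:C - r) * A')
    * ((z - 'i * e%:C - r) * B') = ((z - r) ^+ 4 - e%:C ^+ 4) * (A * B * A' * B').
  have i2 : 'i ^+ 2 = -1 :> R[i] by rewrite sqr_i.
  have -> : (z - r) ^+ 4 - e%:C ^+ 4 = ((z - r) ^+ 2 - e%:C ^+ 2)
      * ((z - r) ^+ 2 - 'i ^+ 2 * e%:C ^+ 2) by rewrite i2; ring.
  by ring.
rewrite (normcM (z - r)) (normcM (_ - _)) exprMn.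
have h1 : normc (z - r) ^+ 4 * (1 - D * e ^+ 4) <= normc ((z - r) ^+ 4 - e%:C ^+ 4).
  by apply: le_trans (normcX4_ge _ _); rewrite /D; rewrite le_eqVlt; apply/orP; left; apply/eqP; field; rewrite ?lt0r_neq0.
apply: (@le_trans _ _ (normc (z - r) ^+ 4 * (1 - D * e ^+ 4)
    * ((1 - C * e ^+ 4) * normc (\prod_(j <- rs) ('X - j%:P)).[z] ^+ 4))).
  set X := normc (z - r) ^+ 4; set Y := normc _ ^+ 4.
  have -> : X * (1 - D * e ^+ 4) * ((1 - C * e ^+ 4) * Y) =
    ((1 - D * e ^+ 4) * (1 - C * e ^+ 4)) * (X * Y) by ring.
  rewrite ler_wpM2r//; first by rewrite mulr_ge0 ?exprn_ge0 ?normc_ge0.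
  by move: (mulr_ge0 Ce0 De0); lra.
apply: ler_pM => //.
  by apply: mulr_ge0; [exact: ltW|lra].
by rewrite mulr_ge0 ?exprn_ge0 ?normc_ge0//; lra.
Qed.

(** Discrete harmonicity of the kernel in [z]. With [a = xi - z], summing [1 / (a - w)] over the
    four fourth roots [w] of [e ^ 4] gives [4 * a ^ 3 / (a ^ 4 - e ^ 4)], which differs from [4 / a]
    by [4 * e ^ 4 / (a * (a ^ 4 - e ^ 4))]. *)
Lemma poisson4 z xi (e : R) : normc xi = 1 -> normc z < 1 ->
  e ^+ 4 <= (1 - normc z) ^+ 4 / 2 ->
  `|poisson (z + e%:C) xi + poisson (z - e%:C) xi
  + poisson (z + 'i * e%:C) xi + poisson (z - 'i * e%:C) xi
  - 4 * poisson z xi| <= 16 / (1 - normc z) ^+ 5 * e ^+ 4.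
Proof.
move=> xi1 z1; set m := 1 - normc z => he.
have m0 : 0 < m by rewrite subr_gt0.
have e0 : 0 <= e ^+ 4 by rewrite exprn_even_ge0.
pose a := xi - z.
have am : m <= normc a by rewrite /m -xi1 lerB_normc.
have a0 : a != 0 by rewrite -normc_gt0 (lt_le_trans m0).
have am4 : m ^+ 4 <= normc a ^+ 4 by rewrite lerXn2r ?nnegrE ?normc_ge0// ltW.
have am5 : m ^+ 4 / 2 <= normc (a ^+ 4 - e%:C ^+ 4).
  by apply: le_trans (normcX4_ge _ _); lra.
have ae0 : a ^+ 4 - e%:C ^+ 4 != 0.
  by rewrite -normc_gt0; apply: lt_le_trans am5; rewrite divr_gt0 ?exprn_gt0.
have i2 : 'i ^+ 2 = -1 :> R[i] by rewrite sqr_i.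
have fact : a ^+ 4 - e%:C ^+ 4 = (a - e%:C) * (a + e%:C) * (a - 'i * e%:C) * (a + 'i * e%:C).
  have -> : a ^+ 4 - e%:C ^+ 4 = (a ^+ 2 - e%:C ^+ 2)
      * (a ^+ 2 - 'i ^+ 2 * e%:C ^+ 2) by rewrite i2; ring.
  by ring.
have := ae0; rewrite fact !mulf_eq0 !negb_or => /andP[/andP[/andP[n1 n2] n3] n4].
have nz w : a - w != 0 -> xi != z + w.
  by apply: contraNneq => h; rewrite /a h addrAC addrK subrr.
rewrite !poissonE ?(nz 0)//; last first.
- exact: nz.
- by apply: nz; rewrite opprK.
- exact: nz.
- by apply: nz; rewrite opprK.
- by rewrite -[z]addr0; apply: nz; rewrite subr0.
have E w : xi - (z + w) = a - w by rewrite /a opprD addrA.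
rewrite !E -/a !opprK.
set S := _ - _.
have -> : S = complex.Re (8 * xi * e%:C ^+ 4 / (a * (a ^+ 4 - e%:C ^+ 4))).
  have -> : 8 * xi * e%:C ^+ 4 / (a * (a ^+ 4 - e%:C ^+ 4)) =
     (2 * xi / (a - e%:C) - 1) + (2 * xi / (a + e%:C) - 1)
    + (2 * xi / (a - 'i * e%:C) - 1) + (2 * xi / (a + 'i * e%:C) - 1)
    - ((4 : R)%:C * (2 * xi / a - 1)).
    have -> : 2 * xi / (a - e%:C) - 1 + (2 * xi / (a + e%:C) - 1) =
       4 * xi * a / (a ^+ 2 - e%:C ^+ 2) - 2.
      have n12 : a ^+ 2 - e%:C ^+ 2 != 0.
        have -> : a ^+ 2 - e%:C ^+ 2 = (a - e%:C) * (a + e%:C) by ring.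
        by rewrite mulf_neq0.
      by field; rewrite n1 n2 n12.
    have n34 : a ^+ 2 + e%:C ^+ 2 != 0.
      have -> : a ^+ 2 + e%:C ^+ 2 = a ^+ 2 - 'i ^+ 2 * e%:C ^+ 2 by rewrite i2; ring.
      have -> : a ^+ 2 - 'i ^+ 2 * e%:C ^+ 2 = (a - 'i * e%:C) * (a + 'i * e%:C) by ring.
      by rewrite mulf_neq0.
    have e3 : (2 * xi / (a - 'i * e%:C) - 1) + (2 * xi / (a + 'i * e%:C) - 1) =
       4 * xi * a / (a ^+ 2 + e%:C ^+ 2) - 2.
      have E4 : a ^+ 2 + e%:C ^+ 2 = (a - 'i * e%:C) * (a + 'i * e%:C).
        by transitivity (a ^+ 2 - 'i ^+ 2 * e%:C ^+ 2); [rewrite i2; ring|ring].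
      by rewrite E4; field; rewrite n3 n4.
    rewrite -[X in _ = X - _]addrA e3 rmorph_nat.
    have n12 : a ^+ 2 - e%:C ^+ 2 != 0.
      have -> : a ^+ 2 - e%:C ^+ 2 = (a - e%:C) * (a + e%:C) by ring.
      by rewrite mulf_neq0.
    have -> : a ^+ 4 - e%:C ^+ 4 = (a ^+ 2 - e%:C ^+ 2) * (a ^+ 2 + e%:C ^+ 2) by ring.
    by field; rewrite a0 n12 n34.
  by rewrite /S !(ReD, ReN, Re_realM).
apply: le_trans (ler_normRe_normc _) _.
rewrite normcM normcV (normcM (8 * xi)) (normcM 8) (normcM a) xi1 mulr1.
have -> : normc (8 : R[i]) = 8 by rewrite -(rmorph_nat (real_complex R)) normc_real.
have -> : normc (e%:C ^+ 4) = e ^+ 4.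
  by rewrite normcX /= expr0n/= addr0 sqrtr_sqr -normrX ger0_norm.
rewrite mulrAC ler_wpM2r//.
have -> : 16 / m ^+ 5 = 8 / (m * (m ^+ 4 / 2)).
  by field; exact: lt0r_neq0.
rewrite ler_wpM2l//.
have mm : 0 < m * (m ^+ 4 / 2) by rewrite mulr_gt0// divr_gt0// exprn_gt0.
have mn : m * (m ^+ 4 / 2) <= normc a * normc (a ^+ 4 - e%:C ^+ 4).
  by apply: ler_pM => //; [exact: ltW|rewrite divr_ge0// exprn_ge0// ltW].
by rewrite lef_pV2// posrE// (lt_le_trans mm).
Qed.

(** The extremal argument below takes place in [R * R], where a closed part of a square is
    compact. *)
Let toC (q : R * R) : R[i] := Complex q.1 q.2.

(** The Poisson integral of the discrete measure with mass [b l] at [xi l]. *)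
Definition poisson_sum N (xi : 'I_N -> R[i]) (b : 'I_N -> R) z : R :=
  \sum_(l < N) b l * poisson z (xi l).

Let contC (x : R) : continuous (fun _ : R * R => x).
Proof. by move=> q; exact: cvg_cst. Qed.

Let cont1 : continuous (fun q : R * R => q.1).
Proof. by move=> q; exact: cvg_fst. Qed.

Let cont2 : continuous (fun q : R * R => q.2).
Proof. by move=> q; exact: cvg_snd. Qed.

Let contD (f g : R * R -> R) : continuous f -> continuous g ->
  continuous (fun q => f q + g q).
Proof. by move=> cf cg q; apply: (cvgD (cf q) (cg q)). Qed.

Let contM (f g : R * R -> R) : continuous f -> continuous g ->
  continuous (fun q => f q * g q).
Proof. by move=> cf cg q; apply: (cvgM (cf q) (cg q)). Qed.

Let contN (f : R * R -> R) : continuous f -> continuous (fun q => - f q).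
Proof. by move=> cf q; apply: (cvgN (cf q)). Qed.

Let contX2 (f : R * R -> R) : continuous f -> continuous (fun q => f q ^+ 2).
Proof. by move=> cf; under eq_fun do rewrite expr2; exact: contM. Qed.

Let cont_sum (I : Type) (r : seq I) (F : I -> R * R -> R) :
  (forall i, continuous (F i)) -> continuous (fun q => \sum_(i <- r) F i q).
Proof.
move=> cF; elim: r => [|i r IH].
  under eq_fun do rewrite big_nil; exact: contC.
by under eq_fun do rewrite big_cons; exact: contD.
Qed.

Let cont_sqr_normc : continuous (fun q => normc (toC q) ^+ 2).
Proof.
by under eq_fun do rewrite normc_sqr /=; apply: contD; exact: contX2.
Qed.

Let cont_sqr_normcB w : continuous (fun q => normc (w - toC q) ^+ 2).
Proof.
under eq_fun do rewrite normc_sqr ReD ImD /=.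
by apply: contD; apply: contX2; apply: contD; [exact: contC|exact: contN
  |exact: contC|exact: contN].
Qed.

Let cont_horner p : continuous (fun q => normc p.[toC q] ^+ 2).
Proof.
suff [cr ci] : continuous (fun q => complex.Re p.[toC q]) /\
    continuous (fun q => complex.Im p.[toC q]).
  by under eq_fun do rewrite normc_sqr /=; apply: contD; exact: contX2.
elim/poly_ind: p => [|p c [IHr IHi]].
  by split; under eq_fun do rewrite horner0; exact: contC.
split.
- under eq_fun do rewrite hornerMXaddC ReD.
  apply: contD; last exact: contC.
  have -> : (fun q0 => complex.Re (p.[toC q0] * toC q0)) =
      fun q0 => complex.Re p.[toC q0] * q0.1 + - (complex.Im p.[toC q0] * q0.2).
    by apply/funext => q0; case: (p.[_]).
  by apply: contD; [exact: contM|apply: contN; exact: contM].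
- under eq_fun do rewrite hornerMXaddC ImD.
  apply: contD; last exact: contC.
  have -> : (fun q0 => complex.Im (p.[toC q0] * toC q0)) =
      fun q0 => complex.Re p.[toC q0] * q0.2 + complex.Im p.[toC q0] * q0.1.
    by apply/funext => q0; case: (p.[_]).
  by apply: contD; exact: contM.
Qed.

(* The cut-off in the denominator makes the kernel globally continuous without
   changing it on the disc of radius [1 - m]. *)
Let poissonc (m : R) z xi : R :=
  (1 - normc z ^+ 2) / Num.max (m ^+ 2) (normc (xi - z) ^+ 2).

Let poissoncE m z xi : 0 <= m -> normc xi = 1 -> normc z <= 1 - m ->
  poissonc m z xi = poisson z xi.
Proof.
move=> m0 xi1 zm; rewrite /poissonc (elimT max_idPr)// lerXn2r ?nnegrE ?normc_ge0//.
by apply: le_trans (lerB_normc _ _); rewrite xi1; lra.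
Qed.

Let cont_poissonc m xi : 0 < m -> continuous (fun q => poissonc m (toC q) xi).
Proof.
move=> m0; apply: contM.
  by apply: contD; [exact: contC|exact: contN].
move=> q; apply: cvgV.
  by rewrite gt_eqF// lt_max exprn_gt0.
have h := @continuous_max R (R * R)%type (fun=> m ^+ 2) (fun q => normc (xi - toC q) ^+ 2) q.
exact: (h (@contC _ q) (@cont_sqr_normcB xi q)).
Qed.

Lemma exists_small (s : seq R) : all (fun x => 0 < x) s ->
  exists2 e : R, 0 < e <= 1 & all (fun x => e <= x) s.
Proof.
elim: s => [_|x s IH /= /andP[x0 /IH[e /andP[e0 e1] es]]]; first by exists 1; rewrite ?ltr01/=.
exists (Num.min e x); first by rewrite lt_min e0 x0 ge_min e1.
rewrite ge_min lexx orbT/=; apply: sub_all es => y ey.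
by rewrite ge_min ey.
Qed.

(** [Y] is the modulus at the centre, [a] the product of the four moduli, [E0] and [S] the
    exponents. The gain [1 + 2 * kap * e ^ 2] beats the loss [(1 - C * e ^ 4) ^ 2], because
    [C * e ^ 4 <= kap * e ^ 2 / 4]. *)
Let four_point_strict (C kap e Y a E0 S : R) : 0 <= C -> 0 < kap -> 0 < e ->
  C * e ^+ 4 <= 1 / 8 -> C * e ^+ 2 <= kap / 4 -> 0 < Y ->
  (1 - C * e ^+ 4) * Y ^+ 4 <= a -> 4 * E0 + 2 * (kap * e ^+ 2) <= S ->
  (Y ^+ 2 * expR E0) ^+ 4 < a ^+ 2 * expR S.
Proof.
move=> C0 kap0 e0 Ce4 Ce2 Y0 ha hS.
have e20 : 0 < e ^+ 2 by rewrite exprn_gt0.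
have e40 : 0 < e ^+ 4 by rewrite exprn_gt0.
have Y8 : 0 < Y ^+ 8 by rewrite exprn_gt0.
rewrite exprMn -expRM_natl -exprM.
apply: (@lt_le_trans _ _ ((1 - C * e ^+ 4) ^+ 2 * Y ^+ 8
    * (expR (4 * E0) * (1 + 2 * (kap * e ^+ 2))))).
  have -> : (1 - C * e ^+ 4) ^+ 2 * Y ^+ 8 * (expR (4 * E0) * (1 + 2 * (kap * e ^+ 2))) =
    (Y ^+ 8 * expR (4 * E0)) * ((1 - C * e ^+ 4) ^+ 2 * (1 + 2 * (kap * e ^+ 2))) by ring.
  rewrite ltr_pMr ?mulr_gt0 ?expR_gt0//.
  have k2 : 0 < kap * e ^+ 2 by rewrite mulr_gt0.
  have : C * e ^+ 4 <= kap * e ^+ 2 / 4.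
    rewrite mulrAC -[e ^+ 4]/(e ^+ (2 + 2)) exprD mulrA.
    by rewrite ler_wpM2r ?(ltW e20).
  have : 0 <= C * e ^+ 4 by rewrite mulr_ge0// ltW.
  by move: (C * e ^+ 4) (kap * e ^+ 2) Ce4 k2 => x y; nra.
apply: ler_pM.
- by rewrite mulr_ge0 ?sqr_ge0 ?ltW.
- by rewrite mulr_ge0 ?expR_ge0// addr_ge0// mulr_ge0// mulr_ge0 ?ltW.
- have l0 : 0 <= (1 - C * e ^+ 4) * Y ^+ 4.
    by apply: mulr_ge0; [lra|rewrite exprn_ge0// ltW].
  rewrite -[Y ^+ 8]/(Y ^+ (4 * 2)) exprM -exprMn lerXn2r// nnegrE.
  exact: le_trans ha.
- apply: le_trans (_ : expR (4 * E0 + 2 * (kap * e ^+ 2)) <= _); last by rewrite ler_expR.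
  by rewrite expRD ler_wpM2l ?expR_ge0// expR_ge1Dx.
Qed.

(** The square of [|p| / exp (u0 + U)], perturbed by a strictly subharmonic factor. Squaring makes
    the modulus a polynomial in the two coordinates, hence visibly continuous. *)
Let weight p N (xi : 'I_N -> R[i]) (b : 'I_N -> R) (u0 kap : R) z : R :=
  normc p.[z] ^+ 2 * expR (- 2 * (u0 + poisson_sum xi b z) + kap * normc z ^+ 2).

Let poisson_sum4 N (xi : 'I_N -> R[i]) (b : 'I_N -> R) z e :
  (forall l, normc (xi l) = 1) -> normc z < 1 -> e ^+ 4 <= (1 - normc z) ^+ 4 / 2 ->
  let U := poisson_sum xi b in
  U (z + e%:C) + U (z - e%:C) + U (z + 'i * e%:C) + U (z - 'i * e%:C)
  - 4 * U z <= \sum_(l < N) `|b l| * (16 / (1 - normc z) ^+ 5) * e ^+ 4.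
Proof.
move=> xi1 z1 he; rewrite /= /poisson_sum mulr_sumr -!big_split/= -sumrB.
apply: le_trans (ler_norm _) _; apply: le_trans (ler_norm_sum _ _ _) _.
apply: ler_sum => l _.
have h := poisson4 (xi1 l) z1 he.
rewrite -[leRHS]mulrA; apply: le_trans (ler_wpM2l (normr_ge0 (b l)) h).
by rewrite -normrM le_eqVlt; apply/orP; left; apply/eqP; congr (`|_|); ring.
Qed.

(* The [kap]-term raises the mean over four points at distance [e] by [kap * e ^ 2],
   while [ln (normc p)] and the Poisson sum change it only by [O(e ^ 4)]. *)
Let weight4 p N (xi : 'I_N -> R[i]) (b : 'I_N -> R) (u0 kap : R) z :
  (forall l, normc (xi l) = 1) -> normc z < 1 -> p.[z] != 0 -> 0 < kap ->
  exists2 d : R, 0 < d & forall e, 0 < e <= d ->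
  let W := weight p xi b u0 kap in
  W z ^+ 4 < W (z + e%:C) * W (z - e%:C) * W (z + 'i * e%:C) * W (z - 'i * e%:C).
Proof.
move=> xi1 z1 pz kap0.
have [C C0 hC] := horner4_ge pz.
have mz0 : 0 < 1 - normc z by lra.
pose C' := \sum_(l < N) `|b l| * (16 / (1 - normc z) ^+ 5).
have C'0 : 0 <= C'.
  by apply: sumr_ge0 => l _; rewrite mulr_ge0// divr_ge0// exprn_ge0// ltW.
have C1 : 0 < C + 1 by rewrite ltr_wpDl.
have C'1 : 0 < C' + 1 by rewrite ltr_wpDl.
(* The four thresholds serve [poisson4], then [C * e ^ 4 <= 1 / 8], then [C * e ^ 2 <= kap / 4],
   then [C' * e ^ 2 <= kap]. *)
have [|d /andP[d0 d1] /= hd] := @exists_small [:: (1 - normc z) ^+ 4 / 2;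
  (8 * (C + 1))^-1; kap / (4 * (C + 1)); kap / (C' + 1)].
  by rewrite /= !divr_gt0 ?invr_gt0 ?exprn_gt0 ?mulr_gt0.
exists d => // e /andP[e0 ed] /=.
have {hd d1 d0 ed d} [e1 e2 [e3 e4] e5] : [/\ e <= 1, e <= (1 - normc z) ^+ 4 / 2,
    e <= (8 * (C + 1))^-1 /\ e <= kap / (4 * (C + 1)) & e <= kap / (C' + 1)].
  by case/and5P: hd => h1 h2 h3 h4 _; do !split; apply: le_trans ed _.
have e22 : e ^+ 2 <= e by rewrite expr2 ler_piMl// ltW.
have e44 : e ^+ 4 <= e ^+ 2.
  rewrite -[leLHS]/(e ^+ (2 + 2)) exprD ler_piMl ?sqr_ge0//.
  exact: le_trans e22 e1.
have e20 : 0 < e ^+ 2 by rewrite exprn_gt0.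
have e40 : 0 < e ^+ 4 by rewrite exprn_gt0.
have CC : C <= C + 1 by rewrite lerDl.
have Ce4 : C * e ^+ 4 <= 1 / 8.
  apply: (@le_trans _ _ ((C + 1) * e)).
    by apply: ler_pM; rewrite ?(ltW e40)//; exact: le_trans e44 e22.
  by move: e3 C0; rewrite invfM -div1r => + C0; rewrite ler_pdivlMr; lra.
have Ce2 : C * e ^+ 2 <= kap / 4.
  apply: (@le_trans _ _ ((C + 1) * e)).
    by apply: ler_pM; rewrite ?(ltW e20).
  by move: e4 C0; rewrite invfM mulrA => + C0; rewrite ler_pdivlMr; lra.
have C'e2 : C' * e ^+ 2 <= kap.
  apply: (@le_trans _ _ ((C' + 1) * e)).
    by apply: ler_pM; rewrite ?(ltW e20)// lerDl.
  by move: e5 C'0; move=> + C'0; rewrite ler_pdivlMr; lra.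
have /hC hp : C * e ^+ 4 <= 1 by apply: le_trans Ce4 _; lra.
have := poisson_sum4 b xi1 z1 (le_trans (le_trans e44 e22) e2).
rewrite /= -mulr_suml -/C'; set U := poisson_sum xi b => hU.
have hn := sum4_sqr_normc z e.
have Y0 : 0 < normc p.[z] by rewrite normc_gt0.
rewrite /weight -/U.
move: hp hU hn; rewrite !normcM.
move: (normc p.[z]) Y0 (normc p.[z + e%:C]) (normc p.[z - e%:C])
  (normc p.[z + 'i * e%:C]) (normc p.[z - 'i * e%:C]) => Y Y0 a1 a2 a3 a4.
move: (normc (z + e%:C)) (normc (z - e%:C)) (normc (z + 'i * e%:C))
  (normc (z - 'i * e%:C)) => n1 n2 n3 n4.
move: (U (z + e%:C)) (U (z - e%:C)) (U (z + 'i * e%:C))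
  (U (z - 'i * e%:C)) (U z) (normc z) => U1 U2 U3 U4 U0 n0 hp hU hn.
have -> : a1 ^+ 2 * expR (- 2 * (u0 + U1) + kap * n1 ^+ 2) *
    (a2 ^+ 2 * expR (- 2 * (u0 + U2) + kap * n2 ^+ 2)) *
    (a3 ^+ 2 * expR (- 2 * (u0 + U3) + kap * n3 ^+ 2)) *
    (a4 ^+ 2 * expR (- 2 * (u0 + U4) + kap * n4 ^+ 2)) =
    (a1 * a2 * a3 * a4) ^+ 2 *
    expR (- 2 * (4 * u0 + (U1 + U2 + U3 + U4)) + kap * (n1 ^+ 2 + n2 ^+ 2 + n3 ^+ 2 + n4 ^+ 2)).
  have -> : - 2 * (4 * u0 + (U1 + U2 + U3 + U4)) +
      kap * (n1 ^+ 2 + n2 ^+ 2 + n3 ^+ 2 + n4 ^+ 2) =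
      (- 2 * (u0 + U1) + kap * n1 ^+ 2) + (- 2 * (u0 + U2) + kap * n2 ^+ 2) +
      (- 2 * (u0 + U3) + kap * n3 ^+ 2) + (- 2 * (u0 + U4) + kap * n4 ^+ 2) by ring.
  by rewrite !expRD; ring.
apply: four_point_strict C0 kap0 e0 Ce4 Ce2 Y0 hp _.
rewrite hn.
have : C' * e ^+ 4 <= kap * e ^+ 2.
  rewrite -[e ^+ 4]/(e ^+ (2 + 2)) exprD mulrA.
  by rewrite ler_wpM2r ?(ltW e20).
by move: hU; lra.
Qed.

(** The region is cut out of the disc by a level of a second Poisson sum, so that it can follow the
    Stolz angles over a set; [b' = 0] and [beta = 1] give the full disc. If the bound failed, the
    perturbed weight would have a maximum inside the region at a point where [p] is not zero,
    against [weight4]. *)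
Lemma maximum_principle p N (xi : 'I_N -> R[i]) (b b' : 'I_N -> R) (u0 beta s : R) :
  (forall l, normc (xi l) = 1) -> s < 1 ->
  (forall z, normc z <= s -> poisson_sum xi b' z <= beta ->
    normc z = s \/ poisson_sum xi b' z = beta ->
    normc p.[z] <= expR (u0 + poisson_sum xi b z)) ->
  forall z, normc z <= s -> poisson_sum xi b' z <= beta ->
    normc p.[z] <= expR (u0 + poisson_sum xi b z).
Proof.
move=> xi1 s1 hb z1 z1s z1b; rewrite leNgt; apply/negP => hz1.
set U := poisson_sum xi b in hb hz1; set B := poisson_sum xi b' in hb z1b.
pose rho := normc p.[z1] ^+ 2 * expR (- 2 * (u0 + U z1)).
have rho1 : 1 < rho.
  have : expR (u0 + U z1) ^+ 2 < normc p.[z1] ^+ 2.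
    by rewrite ltrXn2r// nnegrE ?expR_ge0 ?normc_ge0.
  by rewrite /rho mulNr expRN ltr_pdivlMr ?expR_gt0// mul1r expRM_natl.
(* The perturbation multiplies the weight by at most [expR kap], the square root of [rho], so
   boundary values remain below the value at [z1]. *)
pose kap := ln rho / 2.
have kap0 : 0 < kap by rewrite divr_gt0// ln_gt0.
have kaprho : expR kap < rho.
  have lr : 0 < ln rho by exact: ln_gt0.
  rewrite -[ltRHS]lnK ?posrE; last lra.
  by rewrite ltr_expR /kap; lra.
pose Phi := weight p xi b u0 kap.
have s0 : 0 <= s := le_trans (normc_ge0 _) z1s.
have m0 : 0 < 1 - s by rewrite subr_gt0.
pose Uc z := \sum_(l < N) b l * poissonc (1 - s) z (xi l).
pose Bc z := \sum_(l < N) b' l * poissonc (1 - s) z (xi l).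
have UcE z : normc z <= s -> Uc z = U z.
  by move=> zs; apply: eq_bigr => l _; rewrite poissoncE ?subKr // ltW.
have BcE z : normc z <= s -> Bc z = B z.
  by move=> zs; apply: eq_bigr => l _; rewrite poissoncE ?subKr // ltW.
have cS b0 : continuous (fun q => \sum_(l < N) b0 l * poissonc (1 - s) (toC q) (xi l)).
  by apply: cont_sum => l; apply: contM; [exact: contC|exact: cont_poissonc].
pose Phic z := normc p.[z] ^+ 2 * expR (- 2 * (u0 + Uc z) + kap * normc z ^+ 2).
have PhicE z : normc z <= s -> Phic z = Phi z by move=> zs; rewrite /Phic UcE.
have cPhi : continuous (fun q => Phic (toC q)).
  apply: contM; first exact: cont_horner.
  move=> q; apply: continuous_comp; last exact: continuous_expR.
  apply: contD; last by apply: contM; [exact: contC|exact: cont_sqr_normc].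
  by apply: contM; [exact: contC|apply: contD; [exact: contC|exact: cS]].
pose A := ([set q | normc (toC q) ^+ 2 <= s ^+ 2] `&` [set q | Bc (toC q) <= beta])%classic.
have AE q : A q <-> (normc (toC q) <= s /\ B (toC q) <= beta).
  have -> : A q = (normc (toC q) ^+ 2 <= s ^+ 2 /\ Bc (toC q) <= beta) by [].
  rewrite ler_sqr ?nnegrE ?normc_ge0//.
  by split => -[qs]; rewrite BcE.
have [qs qsA qsmax] : exists2 q, q \in A & forall t, t \in A -> Phic (toC t) <= Phic (toC q).
  apply: (@compact_EVT_max _ R (fun q => Phic (toC q))).
  - by exists (complex.Re z1, complex.Im z1); apply/AE; rewrite /toC; case: (z1) z1s z1b.
  - have cA : closed A.
      apply: closedI.
        apply: (@closed_comp _ _ (fun q => normc (toC q) ^+ 2) [set x | x <= s ^+ 2]%classic).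
          by move=> q _; exact: cont_sqr_normc.
        exact: closed_le.
      apply: (@closed_comp _ _ (fun q => Bc (toC q)) [set x | x <= beta]%classic).
        by move=> q _; exact: cS.
      exact: closed_le.
    apply: (subclosed_compact cA (compact_setX (@segment_compact R (-1) 1)
      (@segment_compact R (-1) 1))).
    move=> q /AE[qs1 _].
    have := lt_le_trans (le_lt_trans qs1 s1) (lexx 1).
    rewrite -(ltr_sqr (R:=R)) ?nnegrE ?normc_ge0// expr1n normc_sqr/= => qs2.
    have q2 := sqr_ge0 q.2; have q1 := sqr_ge0 q.1.
    split => /=; rewrite in_itv/=; apply/andP; split; nra.
  - by apply: continuous_subspaceT.
move/set_mem/AE: (qsA) => [].
set zs := toC qs in qsmax *; move=> zss zsb.
have hmax z : normc z <= s -> B z <= beta -> Phi z <= Phi zs.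
  move=> h1 h2; have := qsmax (complex.Re z, complex.Im z).
  have -> : toC (complex.Re z, complex.Im z) = z by rewrite /toC; case: (z).
  rewrite !PhicE//; apply; apply/mem_set/AE.
  by have -> : toC (complex.Re z, complex.Im z) = z by rewrite /toC; case: (z).
have Phizs : expR kap < Phi zs.
  apply: (lt_le_trans kaprho); apply: le_trans (hmax z1 z1s z1b).
  rewrite /rho /Phi /weight ler_wpM2l ?sqr_ge0// ler_expR lerDl mulr_ge0 ?sqr_ge0//.
  exact: ltW.
have pzs : p.[zs] != 0.
  apply: contraTneq Phizs => h; rewrite /Phi /weight h normc0 expr0n/= mul0r -leNgt.
  exact: expR_ge0.
have [zslt bzlt] : normc zs < s /\ B zs < beta.
  suff : ~ (normc zs = s \/ B zs = beta).
    move=> /not_orP[/eqP h1 /eqP h2].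
    by rewrite lt_neqAle h1 zss lt_neqAle h2 zsb.
  move=> /(hb _ zss zsb) h; move: Phizs; apply/negP; rewrite -leNgt /Phi /weight expRD.
  rewrite mulrA -[leRHS]mul1r; apply: ler_pM; rewrite ?expR_ge0//.
  - by rewrite mulr_ge0 ?expR_ge0 ?sqr_ge0.
  - rewrite mulNr expRN ler_pdivrMr ?expR_gt0// mul1r expRM_natl.
    by rewrite lerXn2r ?nnegrE ?expR_ge0 ?normc_ge0.
  - rewrite ler_expR -[leRHS]mulr1 ler_wpM2l ?(ltW kap0)//.
    by rewrite expr_le1 ?normc_ge0//; lra.
(* By continuity of the second Poisson sum, the four neighbours of the maximum still satisfy its
   strict inequality. *)
have [d d0 hd] : exists2 d : R, 0 < d & forall e, 0 < e -> e < d ->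
    forall z, z \in [:: zs + e%:C; zs - e%:C; zs + 'i * e%:C; zs - 'i * e%:C] ->
    normc z <= s -> B z <= beta.
  have := cS b' qs; rewrite -/zs => /cvgrPdist_lt/(_ (beta - B zs)).
  rewrite subr_gt0 => /(_ bzlt) /nbhs_ballP[d /= d0 hd].
  exists d => // e e0 ed z zin zzs.
  have := hd (complex.Re z, complex.Im z).
  have -> : toC (complex.Re z, complex.Im z) = z by rewrite /toC; case: (z).
  rewrite -/(Bc z) -/(Bc zs) !BcE// => h.
  suff /h : ball qs d (complex.Re z, complex.Im z).
    by rewrite ltr_norml => /andP[]; lra.
  have ez : zs = Complex qs.1 qs.2 by [].
  move: zin; rewrite ez !inE => /or4P[] /eqP -> /=; split; rewrite /ball/=;
  by rewrite ltr_norml; apply/andP; split; lra.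
have zs1 : normc zs < 1 := lt_trans zslt s1.
have [d' d'0 hd'] := @weight4 p N xi b u0 kap zs xi1 zs1 pzs kap0.
have [|e /andP[e0 _] /= /and4P[ed' ed es _]] := @exists_small [:: d'; d / 2; s - normc zs].
  by rewrite /= d'0 divr_gt0// subr_gt0 zslt.
have := hd' e; rewrite e0 ed' => /(_ isT); rewrite /= -/Phi; apply/negP; rewrite -leNgt.
have ne : normc e%:C = e by rewrite normc_real// ltW.
have nie : normc ('i * e%:C) = e.
  by rewrite normcM ne -[normc _]/(Num.sqrt _)/= expr0n expr1n add0r sqrtr1 mul1r.
have hz z : z \in [:: zs + e%:C; zs - e%:C; zs + 'i * e%:C; zs - 'i * e%:C] ->
    Phi z <= Phi zs.
  move=> zin; have zs' : normc z <= s.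
    apply: (@le_trans _ _ (normc zs + e)); last by rewrite -lerBrDl.
    move: zin; rewrite !inE => /or4P[] /eqP ->.
    - by apply: le_trans (ler_normcD _ _) _; rewrite ne.
    - by apply: le_trans (ler_normcB _ _) _; rewrite ne.
    - by apply: le_trans (ler_normcD _ _) _; rewrite nie.
    - by apply: le_trans (ler_normcB _ _) _; rewrite nie.
  apply: hmax => //; apply: (hd e) => //; apply: le_lt_trans ed _.
  by rewrite ltr_pdivrMr// ltr_pMr// ltr1n.
have Phi0 z : 0 <= Phi z by rewrite /Phi /weight mulr_ge0 ?sqr_ge0 ?expR_ge0.
have prod4 (a b0 c d1 m : R) : 0 <= a -> 0 <= b0 -> 0 <= c -> 0 <= d1 ->
    a <= m -> b0 <= m -> c <= m -> d1 <= m -> a * b0 * c * d1 <= m ^+ 4.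
  move=> a0 b00 c0 d10 am bm cm dm; rewrite 3!exprS expr1 !mulrA.
  by rewrite !ler_pM ?mulr_ge0.
by apply: prod4; rewrite ?Phi0//; apply: hz; rewrite !inE eqxx ?orbT.
Qed.
End MaximumPrinciple.

(** * Poisson majorant of the logarithm *)

Section LogMajorant.
Variable R : realType.
Implicit Types (z w : R[i]) (p : {poly R[i]}).

Lemma horner_bounded_lipschitz p : exists B L : R, [/\ 0 <= B, 0 <= L,
  (forall z, normc z <= 1 -> normc p.[z] <= B) &
  (forall z w, normc z <= 1 -> normc w <= 1 ->
    normc (p.[z] - p.[w]) <= L * normc (z - w))].
Proof.
elim/poly_ind: p => [|p c [B [L [B0 L0 hB hL]]]].
  by exists 0, 0; split=> // *; rewrite !horner0 ?subr0 normc0 ?mul0r.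
exists (B + normc c), (B + L); split; rewrite ?addr_ge0 ?normc_ge0//.
  move=> z z1; rewrite hornerMXaddC (le_trans (ler_normcD _ _))// lerD2r normcM.
  by rewrite -[leRHS]mulr1 ler_pM ?normc_ge0// hB.
move=> z w z1 w1; rewrite !hornerMXaddC.
have -> : p.[z] * z + c - (p.[w] * w + c) = p.[z] * (z - w) + (p.[z] - p.[w]) * w.
  by ring.
rewrite (le_trans (ler_normcD _ _))// !normcM mulrDl lerD//.
  by rewrite ler_wpM2r ?normc_ge0// hB.
by rewrite -[leRHS]mulr1 ler_pM ?normc_ge0// hL.
Qed.

Lemma ln_lipschitz (a b tau : R) : 0 < tau -> 0 <= a -> 0 <= b ->
  ln (a + tau) - ln (b + tau) <= `|a - b| / tau.
Proof.
move=> t0 a0 b0; rewrite -ln_div ?posrE ?ltr_wpDl//.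
have -> : (a + tau) / (b + tau) = 1 + (a - b) / (b + tau) by field; lra.
apply: (@le_trans _ _ ((a - b) / (b + tau))).
  by apply: le_ln1Dx; rewrite ltr_pdivlMr; lra.
apply: (@le_trans _ _ (`|a - b| / (b + tau))).
  by rewrite ler_wpM2r ?invr_ge0 ?ler_norm//; lra.
by rewrite ler_wpM2l// lef_pV2 ?posrE//; lra.
Qed.

(** A grid version of the majorant of the subharmonic function [ln |p|] by its Poisson integral.
    Adding [tau] keeps the logarithm bounded and Lipschitz near the zeros of [p]. *)
Lemma log_majorant p (tau rho e : R) : 0 < tau -> 0 <= rho < 1 -> 0 < e ->
  exists N0 : nat, (0 < N0)%N /\ forall N th z, (N0 <= N)%N -> normc z <= rho ->
  normc p.[z] <= expR ((\sum_(j < N) poisson z (grid th N j)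
    * ln (normc p.[grid th N j] + tau)) / N%:R + e).
Proof.
move=> tau0 /andP[rho0 rho1] e0.
have [B [L [B0 L0 hB hL]]] := horner_bounded_lipschitz p.
pose v z := ln (normc p.[z] + tau).
pose V := B + tau + tau^-1; pose K := L / tau.
have K0 : 0 <= K by rewrite divr_ge0// ltW.
have V0 : 0 < V by rewrite addr_gt0 ?invr_gt0//; lra.
have vV z : normc z <= 1 -> `|v z| <= V.
  move=> /hB hz; have pz := normc_ge0 p.[z]; have ti : 0 < tau^-1 by rewrite invr_gt0.
  rewrite ler_norml; apply/andP; split.
    apply: (@le_trans _ _ (- tau^-1)); first by rewrite /V; lra.
    rewrite lerNl -lnV ?posrE; last lra.
    apply: le_trans (ltW (ln_sublinear _)) _; first by rewrite invr_gt0; lra.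
    by rewrite lef_pV2 ?posrE; lra.
  by apply: le_trans (ltW (ln_sublinear _)) _; rewrite /V; lra.
have vK z w : normc z <= 1 -> normc w <= 1 -> v z - v w <= K * normc (z - w).
  move=> z1 w1; apply: le_trans (ln_lipschitz tau0 (normc_ge0 _) (normc_ge0 _)) _.
  rewrite /K mulrAC ler_wpM2r ?invr_ge0 ?(ltW tau0)//.
  apply: le_trans (hL z w z1 w1); rewrite ler_norml lerB_normc andbT.
  by rewrite lerNl opprB normcBC lerB_normc.
(* [t] makes [2 * K * t] at most [e / 3], and [d] makes [2 * d * K / t] at most [e / 3]; the last
   third of [e] pays for the mean of the kernels not being exactly [1]. *)
pose t := e / (6 * (K + 1)).
have K1 : 0 < K + 1 by rewrite ltr_wpDl.
have t0 : 0 < t by rewrite /t !(divr_gt0, mulr_gt0).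
pose d := e * t / (6 * (K + 1)).
have d0 : 0 < d by rewrite /d !(divr_gt0, mulr_gt0).
pose s := Num.max rho (1 - d).
have s1 : s < 1 by rewrite gt_max rho1; lra.
have rs : rho <= s by rewrite le_max lexx.
have ds : 1 - d <= s by rewrite le_max lexx orbT.
have [||N0 [N00 hN0]] := @poisson_mean_cvg R s (Num.min 1 (e / (3 * V))).
- by rewrite s1 (le_trans rho0).
- by rewrite lt_min ltr01 divr_gt0// mulr_gt0.
exists N0; split=> // N th z N0N zrho.
have N_gt0 : 0 < N%:R :> R by rewrite ltr0n (leq_trans N00).
pose b (l : 'I_N) : R := v (grid th N l) / N%:R.
pose g (l : 'I_N) := grid th N l.
have E w : poisson_sum g b w = (\sum_(j < N) poisson w (grid th N j) * v (grid th N j)) / N%:R.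
  by rewrite /poisson_sum mulr_suml; apply: eq_bigr => j _; rewrite /b /g; ring.
rewrite -E addrC.
(* It suffices to compare on [|w| = s], with [s] close to [1]: there the kernels concentrate near
   [w], so the Poisson mean of [v] is close to [v w]. *)
apply: (@maximum_principle R p N g b (fun=> 0) e 1 s) => //.
- by move=> l; exact: normc_grid.
- move=> w ws _ [ws'|]; last first.
    rewrite /poisson_sum big1 => [|l _]; last by rewrite mul0r.
    by move=> /eqP; rewrite eq_sym oner_eq0.
  have w1 : normc w <= 1 by lra.
  apply: (@le_trans _ _ (expR (v w))).
    by rewrite lnK ?posrE ?ltr_wpDl ?normc_ge0// lerDl ltW.
  rewrite ler_expR E.
  have := hN0 N th w N0N ws; set kap := (\sum_(l < N) _) / _ => hk.
  have kV : (1 - kap) * v w <= e / 3.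
    apply: le_trans (ler_norm _) _; rewrite normrM.
    apply: (@le_trans _ _ (e / (3 * V) * V)).
      apply: ler_pM => //; last exact: vV.
      by rewrite distrC (le_trans hk)// ge_min lexx orbT.
    by rewrite le_eqVlt; apply/orP; left; apply/eqP; field; exact: lt0r_neq0.
  have k2 : kap <= 2.
    have : `|kap - 1| <= 1 by rewrite (le_trans hk)// ge_min lexx.
    by rewrite ler_norml => /andP[_]; lra.
  set U := (\sum_(j < N) _) / _.
  suff h : kap * v w - U <= 2 * e / 3 by lra.
  have -> : kap * v w - U = (\sum_(j < N) poisson w (g j) * (v w - v (g j))) / N%:R.
    rewrite /kap /U mulrAC -mulrBl mulr_suml -sumrB; congr (_ / _).
    by apply: eq_bigr => j _; rewrite mulrBr.
  have gw j : g j != w.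
    by apply/eqP => h; move: (normc_grid th N j); rewrite -/(g j) h ws'; lra.
  have P0 j : 0 <= poisson w (g j) by exact: poisson_ge0.
  (* Uses [x <= t + x ^ 2 / t] for [x = |g j - w|]: the kernel times [x ^ 2] is exactly
     [1 - s ^ 2]. *)
  apply: (@le_trans _ _ ((\sum_(j < N) (K * t * poisson w (g j) + K / t * (1 - s ^+ 2))) / N%:R)).
    rewrite ler_wpM2r ?invr_ge0 ?ler0n//; apply: ler_sum => j _.
    have -> : K * t * poisson w (g j) + K / t * (1 - s ^+ 2) =
       poisson w (g j) * (K * (t + normc (g j - w) ^+ 2 / t)).
      rewrite /poisson ws'; field.
      by rewrite (lt0r_neq0 t0) lt0r_neq0// normc_gt0 subr_eq0.
    rewrite ler_wpM2l//; apply: le_trans (vK _ _ _ _) _ => //.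
      by rewrite /g normc_grid.
    rewrite ler_wpM2l// normcBC; set x := normc _.
    have x0 : 0 <= x := normc_ge0 _.
    rewrite -(ler_pM2r t0) mulrDl divfK ?lt0r_neq0//.
    by nra.
  rewrite big_split/= mulrDl -mulr_sumr -mulrA -/kap sumr_const card_ord.
  rewrite -(mulr_natr (_ * (_ - _))) mulfK ?lt0r_neq0//.
  have kap0 : 0 <= kap by apply: divr_ge0; [apply: sumr_ge0 => j _; exact: poisson_ge0|exact: ltW].
  have h1 : K * t * kap <= e / 3.
    apply: (@le_trans _ _ ((K + 1) * t * 2)).
      apply: ler_pM => //; first by rewrite mulr_ge0// ltW.
      by rewrite ler_wpM2r ?(ltW t0)//; lra.
    by rewrite /t le_eqVlt; apply/orP; left; apply/eqP; field; lra.
  have h2 : K / t * (1 - s ^+ 2) <= e / 3.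
    apply: (@le_trans _ _ ((K + 1) / t * (2 * d))).
      apply: ler_pM => //.
      - by rewrite mulr_ge0// invr_ge0 ltW.
      - by rewrite subr_ge0 expr_le1//; [exact: ltW|rewrite (le_trans rho0)].
      - by rewrite ler_wpM2r ?invr_ge0 ?(ltW t0)//; lra.
      - by nra.
    rewrite /d le_eqVlt; apply/orP; left; apply/eqP; field.
    by rewrite (lt0r_neq0 t0) andbT; lra.
  by lra.
- by rewrite (le_trans zrho).
- by rewrite /poisson_sum big1 => [|l _]; rewrite ?mul0r.
Qed.

End LogMajorant.

(** * Stolz angles and barriers *)

Section Barrier.
Variable R : realType.
Implicit Types (z w xi : R[i]) (p : {poly R[i]}).

(** Where the complement of [J] has Poisson sum at most [1 / 2], the point lies in a Stolz angle
    over [J]. Otherwise all of [J] is far from [z], and moving [z] inwards to sixteen times its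
    depth enlarges the kernels at far points; as their total mean is about [1], [J] would carry too
    little of the mass at [z]. *)
Lemma poisson_cone (d : R) : 0 < d < 1 -> exists N0 : nat, (0 < N0)%N /\
  forall N th (J : pred 'I_N) z, (N0 <= N)%N -> normc z <= 1 - d ->
  (\sum_(l < N | ~~ J l) poisson z (grid th N l)) / N%:R <= 1 / 2 ->
  exists2 l, J l & normc (grid th N l - z) <= 32 * (1 - normc z).
Proof.
move=> /andP[d0 d1].
have [||N0 [N00 hN0]] := @poisson_mean_cvg R (1 - d) (1 / 8); [|by lra|].
  by apply/andP; split; lra.
exists N0; split=> // N th J z N0N zd hB.
have N_gt0 : 0 < N%:R :> R by rewrite ltr0n (leq_trans N00).
have hJ : 3 / 8 <= (\sum_(l < N | J l) poisson z (grid th N l)) / N%:R.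
  have := hN0 N th z N0N zd; rewrite (bigID J)/= mulrDl ler_norml => /andP[+ _].
  by move: hB; lra.
apply/not_exists2P => hfar.
have {}hfar l : J l -> 32 * (1 - normc z) < normc (grid th N l - z).
  by move=> Jl; have [//|/negP] := hfar l; rewrite -ltNge.
have z0 := normc_ge0 z.
have gz1 l : normc (grid th N l - z) <= 1 + normc z.
  by rewrite (le_trans (ler_normcB _ _))// normc_grid.
(* Points this deep are within the allowed distance of every grid point, so [J] would be empty. *)
have [hy|hy] := leP 2 (32 * (1 - normc z)).
  move: hJ; rewrite big_pred0 ?mul0r; first by lra.
  by move=> l; apply/negP => /hfar; have := gz1 l; lra.
(* [t%:C * z] lies on the same ray, at depth [16 * y]. *)
pose y := 1 - normc z; pose t := (1 - 16 * y) / (1 - y).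
have t0 : 0 <= t by rewrite divr_ge0// /y; lra.
have nz' : normc (t%:C * z) = 1 - 16 * y.
  rewrite normcM normc_real// /t.
  have -> : normc z = 1 - y by rewrite /y; lra.
  by rewrite divfK// /y; lra.
have zz' : normc (z - t%:C * z) <= 15 * y.
  have t1 : t <= 1 by rewrite ler_pdivrMr /y; lra.
  have -> : z - t%:C * z = (1 - t)%:C * z by rewrite rmorphB/= mulrBl mul1r.
  rewrite normcM normc_real ?subr_ge0// mulrBl mul1r.
  by move: nz'; rewrite normcM normc_real// => ->; rewrite /y; lra.
(* The distances grow by a factor at most [3 / 2], as [15 * y] is below half of [32 * y], and
   [1 - |z| ^ 2] grows at least eightfold: [9 / 4 / 8 = 9 / 32]. *)
have hP l : J l -> poisson z (grid th N l) <= 9 / 32 * poisson (t%:C * z) (grid th N l).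
  move=> /hfar; rewrite /poisson nz' -/y; set g := grid th N l => hg.
  have g' : normc (g - t%:C * z) <= 3 / 2 * normc (g - z).
    have -> : g - t%:C * z = (g - z) + (z - t%:C * z) by ring.
    by apply: le_trans (ler_normcD _ _) _; move: zz' hg; rewrite /y; lra.
  have y0 : 0 < y by rewrite /y; lra.
  have y1 : y < 1 / 16 by rewrite /y; lra.
  have gg0 : 0 < normc (g - t%:C * z).
    rewrite normc_gt0; apply/eqP => h.
    have := lerB_normc g (t%:C * z); rewrite h normc0 nz' normc_grid.
    by move: y0; rewrite /y; lra.
  have g0 : 0 < normc (g - z) by apply: lt_trans hg; rewrite mulr_gt0.
  have -> : normc z = 1 - y by rewrite /y; lra.
  rewrite ler_pdivrMr ?exprn_gt0//.
  have -> : 9 / 32 * ((1 - (1 - 16 * y) ^+ 2) / normc (g - t%:C * z) ^+ 2) *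
      normc (g - z) ^+ 2 = 9 / 32 * (1 - (1 - 16 * y) ^+ 2) * normc (g - z) ^+ 2 /
      normc (g - t%:C * z) ^+ 2 by ring.
  rewrite ler_pdivlMr ?exprn_gt0//.
  have sq : normc (g - t%:C * z) ^+ 2 <= 9 / 4 * normc (g - z) ^+ 2.
    have -> : 9 / 4 * normc (g - z) ^+ 2 = (3 / 2 * normc (g - z)) ^+ 2 by field.
    by rewrite lerXn2r ?nnegrE ?(ltW gg0)// mulr_ge0// ltW.
  apply: (@le_trans _ _ ((1 - (1 - y) ^+ 2) * (9 / 4 * normc (g - z) ^+ 2))).
    rewrite ler_wpM2l//; move: y0 y1; move: (y) => u; nra.
  rewrite mulrA ler_wpM2r ?sqr_ge0//.
  by move: y0 y1; move: (y) => u; nra.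
have z'd : normc (t%:C * z) <= 1 - d by rewrite nz' /y; lra.
have hk := hN0 N th _ N0N z'd.
suff : (\sum_(l < N | J l) poisson z (grid th N l)) / N%:R <=
    9 / 32 * ((\sum_(l < N) poisson (t%:C * z) (grid th N l)) / N%:R).
  by move: hk; rewrite ler_norml => /andP[_]; lra.
rewrite mulrA ler_wpM2r ?invr_ge0 ?(ltW N_gt0)// mulr_sumr.
rewrite [leRHS](bigID J)/=; apply: ler_wpDr.
  by apply: sumr_ge0 => l _; rewrite mulr_ge0// poisson_ge0// nz'; rewrite /y; lra.
by apply: ler_sum => l; exact: hP.
Qed.

Lemma abel_summation (a : nat -> R[i]) z xi d : xi != 0 ->
  \sum_(i < d.+1) a i * z ^+ i =
  (1 - z / xi) * (\sum_(n < d) (\sum_(i < n.+1) a i * xi ^+ i) * (z / xi) ^+ n)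
  + (\sum_(i < d.+1) a i * xi ^+ i) * (z / xi) ^+ d.
Proof.
move=> xi0; elim: d => [|d IH].
  by rewrite big_ord0 mulr0 add0r !big_ord1 !expr0 !mulr1.
rewrite big_ord_recr/= IH [in RHS]big_ord_recr/= [in X in _ = _ + X * _]big_ord_recr/=.
rewrite mulrDr mulrDl -!addrA; congr (_ + _); set T := \sum_(i < d.+1) _.
have -> : a d.+1 * z ^+ d.+1 = a d.+1 * xi ^+ d.+1 * (z / xi) ^+ d.+1.
  by rewrite exprMn exprVn -mulrA (mulrCA (xi ^+ _)) mulfV ?mulr1// expf_neq0.
by move: (a d.+1 * xi ^+ d.+1) => u; rewrite (exprS (z / xi)); ring.
Qed.

(** After summation by parts, the first [m] partial sums cost [C] each, and the others a geometric
    series of total at most [sigma / (1 - |z|)]; the prefactor [|1 - z / xi|] is at most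
    [A * (1 - |z|)]. *)
Lemma abel_stolz (a : nat -> R[i]) z xi (d m : nat) (A C sigma : R) :
  normc xi = 1 -> normc z < 1 -> 1 <= A -> 0 <= C -> 0 <= sigma ->
  normc (xi - z) <= A * (1 - normc z) ->
  (forall n, (n <= d)%N -> normc (\sum_(i < n.+1) a i * xi ^+ i) <= C) ->
  (forall n, (m <= n <= d)%N -> normc (\sum_(i < n.+1) a i * xi ^+ i) <= sigma) ->
  (m <= d)%N ->
  normc (\sum_(i < d.+1) a i * z ^+ i) <= A * (1 - normc z) * (m%:R * C) + A * sigma.
Proof.
move=> xi1 z1 A1 C0 s0 hz hC hs md; have xi0 : xi != 0 by rewrite -normc_gt0 xi1.
set r := normc z in z1 hz *; have r0 : 0 <= r := normc_ge0 z.
have wr : normc (z / xi) = r by rewrite normcM normcV xi1 invr1 mulr1.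
have w1 : normc (1 - z / xi) = normc (xi - z).
  have -> : 1 - z / xi = (xi - z) / xi by field.
  by rewrite normcM normcV xi1 invr1 mulr1.
rewrite (abel_summation _ _ _ xi0); apply: le_trans (ler_normcD _ _) _.
rewrite !normcM normcX wr w1.
have S1 : normc (\sum_(n < d) (\sum_(i < n.+1) a i * xi ^+ i) * (z / xi) ^+ n) <=
    m%:R * C + sigma * \sum_(n < d) r ^+ n.
  apply: le_trans (normc_sum _ _ _) _.
  apply: (@le_trans _ _ (\sum_(n < d) ((n < m)%N%:R * C + sigma * r ^+ n))).
    apply: ler_sum => n _; rewrite normcM normcX wr.
    have rn0 : 0 <= r ^+ n by rewrite exprn_ge0.
    have rn1 : r ^+ n <= 1 by rewrite exprn_ile1// ltW.
    have [nm|mn] := ltnP n m.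
      rewrite mul1r; apply: ler_wpDr; first exact: mulr_ge0.
      by rewrite -[leRHS]mulr1 ler_pM ?normc_ge0//; apply: hC; exact: ltnW.
    by rewrite mul0r add0r ler_wpM2r// hs// mn ltnW.
  rewrite big_split/= -mulr_suml -mulr_sumr lerD2r ler_wpM2r//.
  rewrite -natr_sum ler_nat.
  have -> : (\sum_(n < d) (n < m) = minn d m)%N; last exact: geq_minr.
  elim: (d) => [|k IH]; first by rewrite big_ord0 min0n.
  by rewrite big_ord_recr/= IH; case: ltnP => km; lia.
have geo : (1 - r) * \sum_(n < d) r ^+ n = 1 - r ^+ d.
  by rewrite -[RHS]opprB subrX1; ring.
have rd0 : 0 <= r ^+ d by rewrite exprn_ge0.
have rd1 : r ^+ d <= 1 by rewrite exprn_ile1// ltW.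
apply: (@le_trans _ _ (A * (1 - r) * (m%:R * C + sigma * \sum_(n < d) r ^+ n)
   + sigma * r ^+ d)).
  apply: lerD; last by rewrite ler_wpM2r// hs// md leqnn.
  by apply: ler_pM; rewrite ?normc_ge0.
have -> : A * (1 - r) * (m%:R * C + sigma * \sum_(n < d) r ^+ n) + sigma * r ^+ d =
  A * (1 - r) * (m%:R * C) + (A * sigma * ((1 - r) * \sum_(n < d) r ^+ n) + sigma * r ^+ d).
  by ring.
rewrite lerD2l geo.
have : 0 <= (A - 1) * (sigma * r ^+ d) by rewrite mulr_ge0 ?subr_ge0// mulr_ge0.
by move: (r ^+ d) => x; nra.
Qed.

Lemma poissonC (r : R) (x y : R[i]) : normc x = 1 -> normc y = 1 ->
  poisson (r%:C * x) y = poisson (r%:C * y) x.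
Proof.
move=> x1 y1; rewrite /poisson !normcM x1 y1; congr (_ / _).
have : normc x ^+ 2 = normc y ^+ 2 by rewrite x1 y1.
by rewrite !normc_sqr; case: x {x1} => a b; case: y {y1} => c d /= h; nra.
Qed.

(** A two-constants estimate. Let [B] be the Poisson sum of the complement of [J]. On the region
    [B <= 1 / 2] inside the disc of radius [1 - del], [ln |p|] is compared with the barrier equal to
    [ln (64 * sigma)] at [B = 0] and to [ln (64 * C)] at [B = 1 / 2]. Where [B <= 1 / 4] this gives
    the geometric mean of the two bounds. *)
Lemma good_grid (a : nat -> R[i]) (d m : nat) (C sigma r del : R) :
  (m <= d)%N -> 0 < sigma <= C -> 0 <= r <= 1 - del -> 0 < del < 1 ->
  del * (m%:R * C) <= sigma ->
  exists N0 : nat, (0 < N0)%N /\ forall N th (J : pred 'I_N), (N0 <= N)%N ->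
  (forall l : 'I_N, J l ->
    (forall n, (n <= d)%N -> normc (\sum_(i < n.+1) a i * grid th N l ^+ i) <= C) /\
    (forall n, (m <= n <= d)%N -> normc (\sum_(i < n.+1) a i * grid th N l ^+ i) <= sigma)) ->
  (#|[pred l : 'I_N | (64 * Num.sqrt (C * sigma) <
     normc (\sum_(i < d.+1) a i * (r%:C * grid th N l) ^+ i))%R]| <= 5 * #|[pred l | ~~ J l]|)%N.
Proof.
move=> md /andP[s0 sC] /andP[r0 rd] /andP[d0 d1] hd.
have [|Nc [Nc0 hNc]] := @poisson_cone del; first by rewrite d0.
have [||Nk [Nk0 hNk]] := @poisson_mean_cvg R r (1 / 4); [|by lra|].
  by rewrite r0; lra.
exists (maxn Nc Nk); split; first by rewrite leq_max Nc0.
move=> N th J; rewrite geq_max => /andP[NcN NkN] hJ.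
have N_gt0 : 0 < N%:R :> R by rewrite ltr0n (leq_trans Nc0).
have C0 : 0 < C := lt_le_trans s0 sC.
pose g (l : 'I_N) := grid th N l.
pose b' (l : 'I_N) : R := (~~ J l)%:R / N%:R.
pose Gam := ln C - ln sigma.
have Gam0 : 0 <= Gam by rewrite subr_ge0 ler_ln ?posrE.
pose b (l : 'I_N) : R := 2 * Gam * b' l.
have B'E z : poisson_sum g b' z = (\sum_(l < N | ~~ J l) poisson z (grid th N l)) / N%:R.
  rewrite /poisson_sum mulr_suml [RHS]big_mkcond/=; apply: eq_bigr => l _.
  by rewrite /b'; case: (J l) => /=; rewrite ?mul0r// mul1r mulrC.
have BE z : poisson_sum g b z = 2 * Gam * poisson_sum g b' z.
  by rewrite /poisson_sum mulr_sumr; apply: eq_bigr => l _; rewrite /b mulrA.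
pose p := \poly_(i < d.+1) a i.
have pE z : p.[z] = \sum_(i < d.+1) a i * z ^+ i by rewrite horner_poly.
have B'0 z : normc z <= 1 -> 0 <= poisson_sum g b' z.
  move=> z1; apply: sumr_ge0 => l _; rewrite mulr_ge0 ?poisson_ge0//.
  by rewrite /b' divr_ge0 ?ler0n.
have key z : normc z <= 1 - del -> poisson_sum g b' z <= 1 / 2 ->
    normc p.[z] <= expR (ln (64 * C) - Gam + poisson_sum g b z).
  move: z; apply: maximum_principle => [l||z zd zB]; [exact: normc_grid|lra|].
  have [l Jl hl] := hNc N th J z NcN zd ltac:(by rewrite -B'E).
  have [hT1 hT2] := hJ l Jl.
  have z1 : normc z < 1 by lra.
  have est m' s' := @abel_stolz a z (grid th N l) d m' 32 C s' (normc_grid _ _ _)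
    z1 ltac:(lra) (ltW C0).
  rewrite BE; case=> h.
    (* On the outer circle [1 - |z| = del], so the first [m] partial sums contribute at most
       [32 * sigma]. *)
    have := est m sigma (ltW s0) hl hT1 hT2 md; rewrite -pE => /le_trans; apply.
    apply: (@le_trans _ _ (64 * sigma)).
      by rewrite h subKr -mulrA; lra.
    have B0 : 0 <= 2 * Gam * poisson_sum g b' z.
      by rewrite mulr_ge0 ?mulr_ge0// B'0// ltW.
    apply: (@le_trans _ _ (expR (ln (64 * C) - Gam))); last by rewrite ler_expR lerDl.
    have -> : ln (64 * C) - Gam = ln 64 + ln sigma by rewrite lnM ?posrE// /Gam; ring.
    by rewrite expRD !lnK ?posrE.
  have h0 n : (0 <= n <= d)%N -> normc (\sum_(i < n.+1) a i * grid th N l ^+ i) <= C.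
    by move=> /andP[_]; exact: hT1.
  (* On the level [B = 1 / 2] only the bound [C] is used, with [m = 0]; the barrier is there equal
     to [ln (64 * C)]. *)
  have := est 0%N C (ltW C0) hl hT1 h0 (leq0n _); rewrite -pE => /le_trans; apply.
  rewrite mul0r mulr0 add0r h.
  have -> : ln (64 * C) - Gam + 2 * Gam * (1 / 2) = ln (64 * C) by field.
  by rewrite lnK ?posrE ?mulr_gt0// ler_wpM2r// ?ltW//; lra.
pose B l := poisson_sum g b' (r%:C * g l).
have nr l : normc (r%:C * g l) = r by rewrite normcM normc_real// normc_grid mulr1.
have good l : B l <= 1 / 4 -> normc p.[r%:C * g l] <= 64 * Num.sqrt (C * sigma).
  move=> Bl; have := key (r%:C * g l); rewrite nr => /(_ rd).
  have -> : poisson_sum g b' (r%:C * g l) = B l by [].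
  move=> /(_ ltac:(lra)) /le_trans; apply.
  rewrite BE -/(B l).
  apply: (@le_trans _ _ (expR (ln 64 + (ln C + ln sigma) / 2))).
    rewrite ler_expR lnM ?posrE//.
    have : Gam * B l <= Gam * (1 / 4) by rewrite ler_wpM2l.
    by rewrite /Gam; move: (B l) (ln 64) (ln C) (ln sigma) => *; lra.
  rewrite expRD lnK ?posrE// ler_wpM2l//.
  rewrite -lnM ?posrE//.
  have Cs : 0 < C * sigma by rewrite mulr_gt0.
  rewrite -(@ler_pXn2r _ 2) ?nnegrE ?expR_ge0 ?sqrtr_ge0//.
  rewrite sqr_sqrtr ?(ltW Cs)// -expRM_natl mulrC divfK// lnK// posrE.
apply: (@leq_trans #|[pred l : 'I_N | 1 / 4 < B l]|).
  apply: subset_leq_card; apply/fintype.subsetP => l; rewrite !inE -pE.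
  by rewrite ltNge; apply: contraNT; rewrite -leNgt => /good.
(* Markov's inequality at level [1 / 4]. By symmetry of the kernel each point outside [J] adds at
   most [5 / 4] to the sum of [B] over the circle, whence the factor [5]. *)
rewrite -(ler_nat R) natrM.
apply: (@le_trans _ _ (\sum_(l < N) 4 * B l)).
  rewrite -sum1_card natr_sum big_mkcond/=; apply: ler_sum => l _.
  have Bl0 : 0 <= B l by apply: B'0; rewrite nr; lra.
  by rewrite inE; case: ifP => // ?; lra.
rewrite -mulr_sumr /B /poisson_sum exchange_big/=.
apply: (@le_trans _ _ (4 * \sum_(j < N) ((~~ J j)%:R * (5 / 4)))).
  rewrite ler_wpM2l//; apply: ler_sum => j _.
  rewrite -mulr_sumr /b' -mulrA ler_wpM2l// mulrC.
  under eq_bigr do rewrite poissonC ?normc_grid//.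
  have := hNk N th (r%:C * g j) NkN; rewrite nr => /(_ (lexx _)).
  by rewrite ler_norml => /andP[_]; rewrite /g; lra.
rewrite -mulr_suml -sum1_card natr_sum [X in _ <= _ * X]big_mkcond/=.
rewrite (eq_bigr (fun j : 'I_N => if j \in [pred l | ~~ J l] then 1 else 0)).
  by rewrite mulrA mulrAC; move: (\sum_(i < N) _) => x; lra.
by move=> j _; rewrite inE; case: (J j).
Qed.

End Barrier.

(** * Egorov's theorem on a grid *)

Section GridShift.
Local Open Scope classical_set_scope.
Variable R : realType.
Local Notation mu := (@lebesgue_measure R).

Lemma lebesgue_measure_shift (A : set R) (x : R) : measurable A ->
  mu ((fun t : R => t + x) @^-1` A) = mu A.
Proof.
move=> mA.
have mx : measurable_fun setT (fun t : measurableTypeR R => t + x : measurableTypeR R).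
  apply: continuous_measurable_fun => t.
  by apply: cvgD; [exact: cvg_id|exact: cvg_cst].
apply/esym; rewrite -[RHS]/(pushforward mu (fun t : measurableTypeR R => t + x : measurableTypeR R) A).
apply: lebesgue_measure_unique => // _ [[a b]] _ <-.
rewrite /pushforward.
have E : (fun t : R => t + x) @^-1` `]a, b]%classic = `]a - x, b - x]%classic.
  by apply/seteqP; split => t /=; rewrite !in_itv/= ltrBlDr lerBrDr.
rewrite [in RHS]/= [X in _ = mu X](_ : _ = `]a - x, b - x]%classic)//.
rewrite !lebesgue_measure_itv/= !lte_fin ltrD2r.
by case: ifP => // _; rewrite -!EFinB; congr EFin; ring.
Qed.

(** Integrating the number of grid points in [X] over one mesh length of [th] gives the measure of
    [X] within one period. Were every count above [e * N], this integral would be at least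
    [e * (2 * pi)]. *)
Lemma grid_shift (X : set R) (e : R) (N : nat) : (0 < N)%N -> measurable X ->
  (mu X < (e * (2 * pi))%:E)%E ->
  exists2 th : R, 0 <= th < 2 * pi / N%:R &
    #|[pred l : 'I_N | `[< X (th + l%:R * (2 * pi / N%:R)) >]]|%:R <= e * N%:R.
Proof.
move=> N0 mX muX; set h := 2 * pi / N%:R.
have N_gt0 : 0 < N%:R :> R by rewrite ltr0n.
have h0 : 0 < h by rewrite divr_gt0 ?mulr_gt0 ?pi_gt0.
apply/not_exists2P => hc.
pose S l := (fun t : R => t + l%:R * h) @^-1` X.
have mS l : measurable (S l).
  rewrite -[S l]setTI; apply: (_ : measurable_fun setT (fun t : measurableTypeR R => t + l%:R * h : measurableTypeR R)) => //.
  apply: continuous_measurable_fun => t.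
  by apply: cvgD; [exact: cvg_id|exact: cvg_cst].
pose D := `[0, h[%classic : set R.
have mD : measurable D by exact: measurable_itv.
have muD : mu D = h%:E by rewrite lebesgue_measure_itv/= lte_fin h0 sube0.
have countE th : (#|[pred l : 'I_N | `[< X (th + l%:R * h) >]]|%:R : R)%:E =
    (\sum_(l <- index_enum 'I_N) (\1_(S l) th)%:E)%E.
  rewrite -sum1_card natr_sum big_mkcond/= sumEFin; congr EFin; apply: eq_bigr => l _.
  rewrite indicE inE; case: asboolP => Xt; first by rewrite mem_set.
  by rewrite memNset.
have I1 : (((e * N%:R) * h)%:E <= \int[mu]_(th in D) (\sum_(l <- index_enum 'I_N) (\1_(S l) th)%:E))%E.
  have [e0|e0] := leP 0 e; last first.
    apply: (@le_trans _ _ 0%E).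
      by rewrite lee_fin; rewrite mulr_le0_ge0 ?(ltW h0)// mulr_le0_ge0 ?ltW.
    by apply: integral_ge0 => th _; rewrite sume_ge0// => l _; rewrite lee_fin.
  rewrite EFinM -muD -(integral_cst mu mD).
  apply: ge0_le_integral => //.
  - by move=> th _; rewrite lee_fin mulr_ge0// ltW.
  - apply: emeasurable_sum => l; apply/measurable_EFinP.
    by apply: measurable_indic; exact: mS.
  - move=> th; rewrite /D/= in_itv/= => thD; rewrite -countE lee_fin.
    by have [/negP|/negP] := hc th; rewrite ?thD// -ltNge => /ltW.
have I2 : (\int[mu]_(th in D) (\sum_(l <- index_enum 'I_N) (\1_(S l) th)%:E) =
    \sum_(l < N) mu (S l `&` D))%E.
  rewrite ge0_integral_sum//.
  - by apply: eq_bigr => l _; apply: integral_indic => //; exact: mS.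
  - move=> l; apply/measurable_EFinP; by apply: measurable_indic; exact: mS.
(* The translates of [D] by multiples of [h] tile the interval from [0] to [n * h]. *)
have I3 (n : nat) : (\sum_(l < n) mu (S l `&` D))%E = mu (X `&` `[0, (n%:R * h)[%classic).
  elim: n => [|n IH].
    by rewrite big_ord0 mul0r set_itvco0 setI0 measure0.
  rewrite big_ord_recr/= IH.
  have -> : X `&` `[0, n.+1%:R * h[%classic =
      (X `&` `[0, n%:R * h[%classic) `|` (X `&` `[n%:R * h, n.+1%:R * h[%classic).
    rewrite -setIUr; congr (_ `&` _).
    rewrite -itv_bndbnd_setU ?bnd_simp//.
      by rewrite mulr_ge0// ltW.
    by rewrite ler_wpM2r ?ler_nat// ltW.
  rewrite measureU; last 3 first.
  - by apply: measurableI => //; exact: measurable_itv.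
  - by apply: measurableI => //; exact: measurable_itv.
  - apply/seteqP; split => t //= -[[_ +] [_ +]]; rewrite !in_itv/= => /andP[_ h1] /andP[h2 _].
    by move: (lt_le_trans h1 h2); rewrite ltxx.
  congr (_ + _)%E.
  rewrite -[RHS](@lebesgue_measure_shift _ (n%:R * h)); last first.
    by apply: measurableI => //; exact: measurable_itv.
  congr (mu _); apply/seteqP; split => t [] /=; rewrite /D/= !in_itv/= => Xt.
    move=> /andP[t0 th]; split => //; rewrite lerDr t0/=.
    by rewrite -natr1 mulrDl mul1r addrC ltrD2l.
  move=> /andP[t0 th]; split => //; move: t0 th; rewrite lerDr => ->/=.
  by rewrite -natr1 mulrDl mul1r addrC ltrD2l.
have : (((e * N%:R) * h)%:E <= mu X)%E.
  apply: (le_trans I1); rewrite I2 I3 le_measure ?inE//.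
  by apply: measurableI => //; exact: measurable_itv.
have -> : e * N%:R * h = e * (2 * pi).
  by rewrite /h; field; exact: lt0r_neq0.
by rewrite leNgt muX.
Qed.

Lemma continuous_sym_partial_sum (c : int -> R[i]) N :
  continuous (fun t => normc (sym_partial_sum c N t)).
Proof.
have cD (f g : R -> R) : continuous f -> continuous g -> continuous (fun t => f t + g t).
  by move=> cf cg t; apply: (cvgD (cf t) (cg t)).
have cM (f g : R -> R) : continuous f -> continuous g -> continuous (fun t => f t * g t).
  by move=> cf cg t; apply: (cvgM (cf t) (cg t)).
have cC (x : R) : continuous (fun _ : R => x) by move=> t; exact: cvg_cst.
have c1 (x : R) : continuous (fun t : R => x * t).
  by apply: cM => // t; exact: cvg_id.
have ccos (x : R) : continuous (fun t : R => cos (x * t)).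
  by move=> t; apply: continuous_comp; [exact: c1|exact: continuous_cos].
have csin (x : R) : continuous (fun t : R => sin (x * t)).
  by move=> t; apply: continuous_comp; [exact: c1|exact: continuous_sin].
have csum (I : Type) (r : seq I) (F : I -> R -> R) :
  (forall i, continuous (F i)) -> continuous (fun q => \sum_(i <- r) F i q).
  move=> cF; elim: r => [|i r IH].
    by under eq_fun do rewrite big_nil; exact: cC.
  by under eq_fun do rewrite big_cons; exact: cD.
have hR : continuous (fun t => complex.Re (sym_partial_sum c N t)).
  under eq_fun do rewrite Re_sum; apply: csum => k.
  case: (c _) => a b /=.
  apply: cD; first exact: cM.
  by under eq_fun do rewrite -mulNr; exact: cM.
have hI : continuous (fun t => complex.Im (sym_partial_sum c N t)).
  have Im_sum (I : Type) (r : seq I) (F : I -> R[i]) :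
    complex.Im (\sum_(i <- r) F i) = \sum_(i <- r) complex.Im (F i).
    by elim/big_ind2: _ => [//|x1 x2 y1 y2 <- <-|//]; rewrite ImD.
  under eq_fun do rewrite Im_sum; apply: csum => k.
  by case: (c _) => a b /=; apply: cD; exact: cM.
have -> : (fun t => normc (sym_partial_sum c N t)) =
    fun t => Num.sqrt (complex.Re (sym_partial_sum c N t) * complex.Re (sym_partial_sum c N t)
    + complex.Im (sym_partial_sum c N t) * complex.Im (sym_partial_sum c N t)).
  by apply/funext => t; case: (sym_partial_sum c N t).
move=> t; apply: continuous_comp; last exact: sqrt_continuous.
by apply: cD; exact: cM.
Qed.

(* The shift [th] exists because the mean of the counts over all shifts is the measure. *)
Lemma uniform_on_grid (c : int -> R[i]) (e : R) : 0 < e ->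
  {ae mu, forall t : R, sym_sums_to_zero c t} ->
  exists good : R -> bool,
  (forall eta : R, 0 < eta -> exists n0 : nat, forall m t, (n0 <= m)%N -> good t ->
    normc (sym_partial_sum c m t) <= eta) /\
  (forall N, (0 < N)%N -> exists th : R,
    #|[pred l : 'I_N | ~~ good (th + l%:R * (2 * pi / N%:R))]|%:R <= e * N%:R).
Proof.
move=> e0 cae.
pose f (m : nat) (t : R) := normc (sym_partial_sum c m t).
pose A := `[0, 2 * pi]%classic : set R.
have pi0 := pi_gt0 R.
have muA : mu A = (2 * pi)%:E by rewrite lebesgue_measure_itv/= lte_fin mulr_gt0// sube0.
have [||||||B [mB muB unif]] := @ae_pointwise_almost_uniform _ R _ mu f (fun=> 0) A (e * (2 * pi)).
- move=> n; apply: measurable_funTS; apply: continuous_measurable_fun.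
  exact: continuous_sym_partial_sum.
- exact: measurable_cst.
- exact: measurable_itv.
- by rewrite -[X in (X < _)%E]/(mu A) muA ltry.
- case: cae => C [mC C0 hC]; exists C; split=> // t /= ht'; apply: hC => ht; apply: ht' => _.
  apply/cvgrPdist_le => eta eta0; have [N0 hN0] := ht eta eta0.
  exists N0 => // n N0n; have := hN0 n N0n; rewrite ltr_normcE => /ltW h.
  by rewrite sub0r normrN ger0_norm ?normc_ge0.
- by rewrite !mulr_gt0.
exists (fun t => `[< A t /\ ~ B t >]); split.
  move=> eta eta0.
  have [n _ hn] : \forall n \near \oo, forall t, (A `\` B) t -> `|f n t| <= eta.
    have := unif [set h : {uniform` (A `\` B) -> R} | forall t, (A `\` B) t -> `|h t| <= eta].
    apply; apply/uniform_nbhs.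
    exists [set xy : R * R | ball xy.1 eta xy.2]; split.
      exact: entourage_ball (PosNum eta0).
    move=> h /= hh t ABt; have := hh t ABt.
    by rewrite /ball/= sub0r normrN => /ltW.
  exists n => m t nm /asboolP ABt; have := hn m nm t ABt.
  by rewrite ger0_norm ?normc_ge0.
move=> N N0; have [th /andP[th0 thh] hth] := grid_shift N0 mB muB.
exists th; apply: le_trans hth; rewrite ler_nat.
apply: subset_leq_card; apply/fintype.subsetP => l; rewrite !inE.
move/asboolPn/not_andP => [hA|/contrapT hB]; last exact: hB.
(* Since [th] is smaller than one mesh length, no grid angle exceeds [2 * pi]. *)
exfalso; apply: hA; rewrite /A/= in_itv/=.
have N_gt0 : 0 < N%:R :> R by rewrite ltr0n.
have h0 : 0 < 2 * pi / N%:R :> R by rewrite divr_gt0 ?mulr_gt0.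
rewrite addr_ge0 ?(mulr_ge0 (ler0n _ _) (ltW h0))//=.
apply: (@le_trans _ _ ((l.+1)%:R * (2 * pi / N%:R))).
  have -> : l.+1%:R = l%:R + 1 :> R by rewrite natr1.
  by rewrite (mulrDl l%:R) mul1r [leLHS]addrC lerD2l ltW.
rewrite mulrA ler_pdivrMr// mulrC ler_wpM2l ?ler_nat//.
by rewrite mulr_ge0// ltW.
Qed.

End GridShift.

(** * Truncated series *)

Section Truncation.
Variables (R : realType) (c : int -> R[i]).
Implicit Types (M L N n k : nat) (z : R[i]) (t : R).

(** The polynomial [H_k] when [M = scale k]; the index [i] stands for the frequency [i - M]. *)
Definition trunc M L z : R[i] := \sum_(i < (M + L).+1) c (i%:Z - M%:Z) * z ^+ i.

Definition neg_tail M N : R := \sum_(M.+1 <= n < N.+1) normc (c (- n%:Z)).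

Lemma neg_tailE M N : (M <= N)%N ->
  \sum_(i < N - M) normc (c (i%:Z - N%:Z)) = neg_tail M N.
Proof.
move=> MN; rewrite /neg_tail big_nat_rev/= -{1}[M.+1]add0n big_addn subSS big_mkord.
apply: eq_bigr => i _; congr (normc (c _)).
have := ltn_ord i; lia.
Qed.

Lemma neg_tail_ge0 M N : 0 <= neg_tail M N.
Proof. by apply: sumr_ge0 => i _; exact: normc_ge0. Qed.

Lemma neg_tail_le0 M N : neg_tail M N <= neg_tail 0 N.
Proof.
have [MN|NM] := leqP M N; last by rewrite {1}/neg_tail big_geq ?neg_tail_ge0// ltnS ltnW.
rewrite [leRHS]/neg_tail (@big_cat_nat _ _ _ M.+1)//= lerDr.
by apply: sumr_ge0 => i _; exact: normc_ge0.
Qed.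

Lemma trunc_split M N L z : (M <= N)%N ->
  trunc N L z = \sum_(i < N - M) c (i%:Z - N%:Z) * z ^+ i + z ^+ (N - M) * trunc M L z.
Proof.
move=> MN; rewrite /trunc.
have -> : (N + L).+1 = ((N - M) + (M + L).+1)%N by lia.
rewrite big_split_ord/=; congr (_ + _); rewrite mulr_sumr; apply: eq_bigr => i _.
rewrite exprD mulrCA; congr (_ * (c _ * _)); lia.
Qed.

Lemma normc_sum_unit (n : nat) (a : nat -> R[i]) z : normc z <= 1 ->
  normc (\sum_(i < n) a i * z ^+ i) <= \sum_(i < n) normc (a i).
Proof.
move=> z1; apply: le_trans (normc_sum _ _ _) _; apply: ler_sum => i _.
rewrite normcM normcX -[leRHS]mulr1 ler_pM ?normc_ge0 ?exprn_ge0 ?normc_ge0//.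
by rewrite exprn_ile1 ?normc_ge0.
Qed.

Lemma trunc_bound M L z (C : R) : (forall n : int, normc (c n) <= C) -> normc z < 1 ->
  normc (trunc M L z) <= C / (1 - normc z).
Proof.
move=> hC z1; have C0 : 0 <= C := le_trans (normc_ge0 _) (hC 0).
apply: le_trans (normc_sum _ _ _) _.
apply: (@le_trans _ _ (C * \sum_(i < (M + L).+1) normc z ^+ i)).
  rewrite mulr_sumr; apply: ler_sum => i _.
  rewrite normcM normcX; apply: ler_wpM2r; last exact: hC.
  by rewrite exprn_ge0 ?normc_ge0.
rewrite ler_wpM2l// -div1r ler_pdivlMr ?subr_gt0//.
have := subrX1 (normc z) (M + L).+1.
move: (\sum_(i < _) _) => S h.
have : 0 <= normc z ^+ (M + L).+1 by rewrite exprn_ge0 ?normc_ge0.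
by move: h; move: (normc z ^+ (M + L).+1) (normc z) => x y; nra.
Qed.

Lemma sym_partial_sumE n t : sym_partial_sum c n t = expi (- (n%:R * t)) * trunc n n (expi t).
Proof.
rewrite /sym_partial_sum /trunc addnn mulr_sumr; apply: eq_bigr => i _.
rewrite mulrCA; congr (_ * _); rewrite -expiM_nat -expiD; congr expi.
by rewrite intrB mulrBl addrC.
Qed.

Lemma normc_sym_partial_sum n t : normc (sym_partial_sum c n t) = normc (trunc n n (expi t)).
Proof. by rewrite sym_partial_sumE normcM normc_expi mul1r. Qed.

Lemma trunc_unit_split M N L t : (M <= N)%N ->
  normc (trunc M L (expi t)) <= normc (trunc N L (expi t)) + neg_tail M N /\
  normc (trunc N L (expi t)) <= normc (trunc M L (expi t)) + neg_tail M N.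
Proof.
move=> MN; have h := trunc_split L (expi t) MN.
have s : normc (\sum_(i < N - M) c (i%:Z - N%:Z) * expi t ^+ i) <= neg_tail M N.
  rewrite -neg_tailE//.
  by apply: (@normc_sum_unit _ (fun i => c (i%:Z - N%:Z))); rewrite normc_expi.
have e : normc (expi t ^+ (N - M) * trunc M L (expi t)) = normc (trunc M L (expi t)).
  by rewrite normcM normcX normc_expi expr1n mul1r.
split.
  rewrite -e; have -> : expi t ^+ (N - M) * trunc M L (expi t) = trunc N L (expi t) -
    \sum_(i < N - M) c (i%:Z - N%:Z) * expi t ^+ i by rewrite h addrAC subrr add0r.
  by apply: le_trans (ler_normcB _ _) _; rewrite lerD2l.
by rewrite h; apply: le_trans (ler_normcD _ _) _; rewrite addrC e lerD2l.
Qed.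

(** Both sides have the same highest frequency [n]. After multiplication by a unimodular factor they
    differ only in frequencies below [- minn M n]. *)
Lemma trunc_sym_partial_sum M n t :
  normc (trunc M n (expi t)) <= normc (sym_partial_sum c n t) + neg_tail (minn M n) (maxn M n).
Proof.
rewrite normc_sym_partial_sum; have [Mn|nM] := leqP M n.
  by have [] := trunc_unit_split n t Mn.
by have [] := trunc_unit_split n t (ltnW nM).
Qed.

(** Supplies the partial sums needed for [abel_stolz]. Those of degree below [M] involve negative
    frequencies only; the others are truncations with cut-off [j - M]. *)
Lemma trunc_partial_sum M j t (C2 : R) : (forall N, neg_tail 0 N <= C2) ->
  normc (\sum_(i < j.+1) c (i%:Z - M%:Z) * expi t ^+ i) <=
  (if (M <= j)%N then normc (sym_partial_sum c (j - M) t) else 0) + C2.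
Proof.
move=> hC2; case: leqP => Mj.
  have -> : \sum_(i < j.+1) c (i%:Z - M%:Z) * expi t ^+ i = trunc M (j - M) (expi t).
    by rewrite /trunc; have -> : (M + (j - M)).+1 = j.+1 by lia.
  apply: le_trans (trunc_sym_partial_sum _ _ _) _; rewrite lerD2l.
  exact: le_trans (neg_tail_le0 _ _) (hC2 _).
rewrite add0r; apply: le_trans (hC2 M).
apply: le_trans (_ : _ <= \sum_(i < j.+1) normc (c (i%:Z - M%:Z))) _.
  by apply: (@normc_sum_unit _ (fun i => c (i%:Z - M%:Z))); rewrite normc_expi.
rewrite -(neg_tailE (leq0n M)) subn0 -!(big_mkord xpredT (fun i => normc (c (i%:Z - M%:Z)))).
rewrite [leRHS](@big_cat_nat _ _ _ j.+1)//= lerDl.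
by apply: sumr_ge0 => i _; exact: normc_ge0.
Qed.

Lemma normc_sym_partial_sum_le n t (C : R) : (forall n : int, normc (c n) <= C) ->
  normc (sym_partial_sum c n t) <= C *+ (n + n).+1.
Proof.
move=> hC; rewrite normc_sym_partial_sum.
apply: le_trans (_ : _ <= \sum_(i < (n + n).+1) normc (c (i%:Z - n%:Z))) _.
  by apply: (@normc_sum_unit _ (fun i => c (i%:Z - n%:Z))); rewrite normc_expi.
apply: le_trans (ler_sum _ (fun i _ => hC _)) _.
by rewrite sumr_const card_ord.
Qed.

End Truncation.

(** * Flow of mass through bad points *)

Section Core.
Variables (R : realType) (c : int -> R[i]) (b : nat -> R) (Cc C2 : R) (kt : nat).

Definition scale k : nat := 4 ^ (2 ^ k).
(** [H_(k+1)] is [z ^ (scale k.+1 - scale k) * H_k] up to a small error. As [scale k.+2] is the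
    square of [scale k.+1], this power has modulus at least [1 - 1 / scale k.+1] on
    [|z| = rad k.+1]. *)
Definition rad k : R := 1 - (scale k.+1)%:R^-1.
Definition gam k : R := b k * 2 ^+ k / 16.

Hypothesis c_bd : forall n : int, normc (c n) <= Cc.
Hypothesis Cc1 : 1 <= Cc.
Hypothesis neg_bd : forall N, neg_tail c 0 N <= C2.
Hypothesis tail_bd : forall k N, (kt <= k)%N -> neg_tail c (scale k) N <= expR (- 4 * gam k).
Hypothesis b_mono : forall k, b k <= b k.+1.
Hypothesis b_gt0 : forall k, 0 < b k.
Hypothesis b_le : forall k, b k <= 2 ^+ k.
Hypothesis b_sum : forall e : R, 0 < e -> exists k1 : nat, forall n m, (k1 <= n)%N ->
  \sum_(n <= j < m) (b j)^-1 <= e.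
Hypothesis c_ae : {ae (@lebesgue_measure R), forall t : R, sym_sums_to_zero c t}.

(** * Elementary properties of scales, radii and exponents *)

Lemma scaleS k : scale k.+1 = (scale k ^ 2)%N.
Proof. by rewrite /scale expnS mulnC expnM. Qed.

Lemma scale_gt k : (2 ^ k < scale k)%N.
Proof. exact: ltn_expl. Qed.

Lemma scale_ge4 k : (4 <= scale k)%N.
Proof. by rewrite -{1}(expn1 4) leq_pexp2l// expn_gt0. Qed.

Lemma scale_gt0 k : 0 < (scale k)%:R :> R.
Proof. by rewrite ltr0n (leq_trans _ (scale_ge4 k)). Qed.

Lemma scaleV_le k : (scale k)%:R^-1 <= 1 / 4 :> R.
Proof. by rewrite div1r lef_pV2 ?posrE ?scale_gt0// ler_nat scale_ge4. Qed.

Lemma rad_lt1 k : rad k < 1.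
Proof. by rewrite gtrBl invr_gt0 scale_gt0. Qed.

Lemma rad_ge k : 3 / 4 <= rad k.
Proof. by rewrite /rad; have := scaleV_le k.+1; lra. Qed.

Lemma rad_lt k : rad k < rad k.+1.
Proof.
rewrite ltrD2l ltrN2 ltf_pV2 ?posrE ?scale_gt0// ltr_nat (scaleS k.+1) -mulnn.
by rewrite ltn_Pmull// (leq_trans _ (scale_ge4 _)).
Qed.

Lemma bernoulli_le (x : R) n : 0 <= x <= 1 -> 1 - n%:R * x <= (1 - x) ^+ n.
Proof.
move=> /andP[x0 x1]; elim: n => [|n IH]; first by rewrite mul0r subr0 expr0.
rewrite exprS -natr1; apply: le_trans (ler_wpM2l _ IH); last lra.
have n0 : 0 <= n%:R * x by rewrite mulr_ge0.
by nra.
Qed.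

Lemma gam_gt0 k : 0 < gam k.
Proof. by rewrite /gam divr_gt0// mulr_gt0// exprn_gt0. Qed.

Lemma gam_mono k : gam k <= gam k.+1.
Proof.
rewrite /gam ler_wpM2r// ler_pM ?exprn_ge0 ?(ltW (b_gt0 _))//.
by rewrite ler_weXn2l// ler1n.
Qed.

Lemma b_mono_le j k : (j <= k)%N -> b j <= b k.
Proof.
move=> /subnK <-; elim: (k - j)%N => [|n IH]; first by rewrite add0n.
by rewrite addSn (le_trans IH).
Qed.

Lemma two_expn_ge n : n%:R <= 2 ^+ n :> R.
Proof. by rewrite -natrX ler_nat ltnW// ltn_expl. Qed.

Lemma gam_unbounded (x : R) : exists k1, forall k, (k1 <= k)%N -> x <= gam k.
Proof.
have [k1 hk1] : exists k1 : nat, x * 16 / b 0%N <= k1%:R.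
  by exists (Num.truncn (x * 16 / b 0%N)).+1; rewrite ltW// truncnS_gt.
exists k1 => k k1k; rewrite /gam ler_pdivlMr//.
apply: (@le_trans _ _ (b 0%N * k1%:R)).
  by rewrite [leRHS]mulrC -ler_pdivrMr.
apply: ler_pM; rewrite ?(ltW (b_gt0 _))// ?b_mono_le//.
by apply: le_trans (two_expn_ge k); rewrite ler_nat.
Qed.

Lemma trunc_step k L z : (kt <= k)%N -> normc z = rad k.+1 ->
  normc (trunc c (scale k) L z) <=
  (1 + 2 / (scale k.+1)%:R) * normc (trunc c (scale k.+1) L z) + 2 * expR (- 4 * gam k).
Proof.
move=> ktk zr; set x : R := (scale k.+1)%:R^-1.
have x4 : x <= 1 / 4 := scaleV_le k.+1.
have x0 : 0 < x by rewrite invr_gt0 scale_gt0.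
have MN : (scale k <= scale k.+1)%N.
  by rewrite scaleS -mulnn leq_pmull// (leq_trans _ (scale_ge4 k)).
have h := trunc_split c L z MN.
set D := (scale k.+1 - scale k)%N in h.
have z1 : normc z <= 1 by rewrite zr ltW// rad_lt1.
have s : normc (\sum_(i < D) c (i%:Z - (scale k.+1)%:Z) * z ^+ i) <= expR (- 4 * gam k).
  apply: le_trans (tail_bd (scale k.+1) ktk); rewrite -(neg_tailE c MN).
  exact: (@normc_sum_unit _ _ (fun i => c (i%:Z - (scale k.+1)%:Z))).
have zD : 1 - x <= normc z ^+ D.
  rewrite zr /rad; apply: le_trans (bernoulli_le _ _); last first.
    have := scaleV_le k.+2; have := scale_gt0 k.+2; rewrite -invr_gt0; lra.
  rewrite lerB// (scaleS k.+1) natrX -exprVn -/x expr2 mulrA -[leRHS]mul1r.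
  rewrite ler_wpM2r ?(ltW x0)// ler_pdivrMr ?scale_gt0// mul1r ler_nat.
  exact: leq_subr.
have e : normc z ^+ D * normc (trunc c (scale k) L z) <=
    normc (trunc c (scale k.+1) L z) + expR (- 4 * gam k).
  rewrite -normcX -normcM.
  have -> : z ^+ D * trunc c (scale k) L z = trunc c (scale k.+1) L z -
    \sum_(i < D) c (i%:Z - (scale k.+1)%:Z) * z ^+ i by rewrite h addrAC subrr add0r.
  by apply: le_trans (ler_normcB _ _) _; rewrite lerD2l.
have e0 := expR_gt0 (- 4 * gam k).
move: (normc_ge0 (trunc c (scale k) L z)) (normc_ge0 (trunc c (scale k.+1) L z)) e e0.
move: (normc (trunc c (scale k) L z)) (normc (trunc c (scale k.+1) L z)).
move: (expR _) (normc z ^+ D) zD => E y zD A B A0 B0 h1 E0.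
have h2 : (1 - x) * A <= B + E by apply: le_trans h1; rewrite ler_wpM2r.
(* Valid because [(1 + 2 * x) * (1 - x) >= 1] for [0 <= x <= 1 / 2]. *)
have h3 : A <= (1 + 2 * x) * ((1 - x) * A).
  have : 0 <= A * (x * (1 - 2 * x)) by rewrite mulr_ge0// mulr_ge0//; [exact: ltW|lra].
  by lra.
apply: (le_trans h3); apply: (@le_trans _ _ ((1 + 2 * x) * (B + E))).
  by rewrite ler_wpM2l//; lra.
rewrite mulrDr lerD2l ler_wpM2r//; lra.
Qed.

(** Step 1 of the strategy: [good_grid] applied to [H_k] over the good set. The order of choice is
    the level, then the cut-off [L], then the grid size, then the rotation; the good set depends on
    [eps] alone. *)
Lemma good_fraction (eps : R) : 0 < eps -> exists k1 : nat, forall k, (k1 <= k)%N ->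
  exists L1 : nat, forall L, (L1 <= L)%N -> exists N1 : nat, (0 < N1)%N /\
  forall N, (N1 <= N)%N -> exists th : R,
  #|[pred l : 'I_N | expR (- gam k) <
      normc (trunc c (scale k) L ((rad k)%:C * grid th N l))]|%:R <= eps * N%:R.
Proof.
move=> eps0.
(* Division by [5] compensates the factor [5] of [good_grid]. *)
have [|good [hunif hgrid]] := @uniform_on_grid R c (eps / 5) _ c_ae; first by lra.
have [n0 hn0] := hunif 1 ltr01.
have C20 : 0 <= C2 by apply: le_trans (neg_bd 0); exact: neg_tail_ge0.
have [W [CcW WE]] : exists W, Cc <= W /\ Cc *+ (n0 + n0).+1 = W.
  exists (Cc *+ (n0 + n0).+1); split=> //.
  by rewrite mulrS lerDl mulrn_wge0// (le_trans ler01).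
(* [W] bounds the symmetric sums of order below [n0] and [1] the later ones. Since [n0] does not
   depend on [k], neither does [C], which lets [gam k] outgrow it. *)
pose C := C2 + W + 1.
have W0 : 0 <= W by rewrite (le_trans ler01)// (le_trans Cc1).
have C1 := Cc1.
have C2le : 2 <= C by rewrite /C; lra.
have C0 : 0 < C by lra.
have [k1 hk1] := gam_unbounded (8192 * C).
exists (maxn kt k1) => k; rewrite geq_max => /andP[ktk /hk1 gC].
have [n1 hn1] := hunif (expR (- 4 * gam k)) (expR_gt0 _).
set M := scale k; set s := expR (- 4 * gam k).
have s0 : 0 < s := expR_gt0 _.
have s1 : s <= 1 by rewrite -expR0 ler_expR mulNr oppr_le0 mulr_ge0// ltW// gam_gt0.
exists (maxn n1 M) => L; rewrite geq_max => /andP[n1L ML].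
(* From degree [m] on, the symmetric sum has order at least [n1], so it is at most [s], and order at
   least [M], so that the omitted coefficients also cost at most [s]. *)
pose m := (M + maxn n1 M)%N.
pose del := Num.min ((scale k.+1)%:R^-1) (2 * s / (m%:R * C)).
have m0 : 0 < m%:R * C by rewrite mulr_gt0// ltr0n addn_gt0 (leq_trans _ (scale_ge4 k)).
have del0 : 0 < del by rewrite lt_min invr_gt0 scale_gt0 divr_gt0// mulr_gt0.
have del1 : del <= 1 / 4 by rewrite ge_min scaleV_le.
have [|||||Ng [Ng0 hNg]] := @good_grid R (fun i => c (i%:Z - M%:Z)) (M + L) m C (2 * s) (rad k) del.
- by rewrite leq_add2l geq_max n1L.
- by rewrite mulr_gt0//= (le_trans _ C2le)// ler_piMr.
- by rewrite (le_trans _ (rad_ge k)) ?divr_ge0//= lerD2l lerN2 ge_min lexx.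
- by rewrite del0 (le_lt_trans del1)// ltr_pdivrMr// mul1r ltr1n.
- by rewrite -ler_pdivlMr// ge_min lexx orbT.
exists Ng; split => // N NgN; have [th hth] := hgrid N (leq_trans Ng0 NgN).
exists th.
have hJ (l : 'I_N) : good (th + l%:R * (2 * pi / N%:R)) ->
    (forall n, (n <= M + L)%N ->
      normc (\sum_(i < n.+1) c (i%:Z - M%:Z) * grid th N l ^+ i) <= C) /\
    (forall n, (m <= n <= M + L)%N ->
      normc (\sum_(i < n.+1) c (i%:Z - M%:Z) * grid th N l ^+ i) <= 2 * s).
  move=> gl; split=> n.
    move=> nd; apply: le_trans (trunc_partial_sum _ _ _ neg_bd) _.
    rewrite addrC /C -addrA lerD2l; case: leqP => _; last by rewrite addr_ge0.
    have [h|h] := leqP n0 (n - M).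
      by apply: le_trans (hn0 _ _ h gl) _; rewrite lerDr.
    apply: le_trans (normc_sym_partial_sum_le _ _ c_bd) _.
    apply: (@le_trans _ _ W); last by rewrite lerDl.
    by rewrite -WE ler_wpMn2l ?(le_trans ler01)// ltnS leq_add// ltnW.
  move=> /andP[mn nd].
  have Mn : (M <= n)%N by rewrite (leq_trans _ mn)// leq_addr.
  have -> : \sum_(i < n.+1) c (i%:Z - M%:Z) * grid th N l ^+ i =
      trunc c M (n - M) (grid th N l).
    by rewrite /trunc subnKC.
  apply: le_trans (trunc_sym_partial_sum _ _ _ _) _.
  have : (maxn n1 M <= n - M)%N by rewrite leq_subRL// .
  rewrite geq_max => /andP[h1 h2].
  rewrite (minn_idPl h2) (maxn_idPr h2) [2 * s]mulr_natl mulr2n; apply: lerD.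
    exact: hn1.
  exact: tail_bd.
have hcard := hNg N th _ NgN hJ.
apply: (@le_trans _ _ (5 * #|[pred l : 'I_N | ~~ good (th + l%:R * (2 * pi / N%:R))]|%:R)); last first.
  apply: le_trans (ler_wpM2l (ler0n _ 5) hth) _.
  by rewrite le_eqVlt; apply/orP; left; apply/eqP; field.
rewrite -natrM ler_nat; apply: leq_trans hcard.
apply: subset_leq_card; apply/fintype.subsetP => l; rewrite !inE; apply: le_lt_trans.
rewrite -(@ler_pXn2r _ 2) ?nnegrE ?mulr_ge0 ?sqrtr_ge0 ?expR_ge0//.
rewrite exprMn sqr_sqrtr; last by rewrite mulr_ge0 ?mulr_ge0 ?(ltW C0) ?(ltW s0).
rewrite /s -expRM_natl.
have -> : - 4 * gam k = 2 * - gam k + 2 * - gam k by rewrite -mulrDl -mulr2n; ring.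
rewrite expRD; have e0 := expR_gt0 (2 * - gam k).
(* [8192 = 64 ^ 2 * 2] comes from squaring [64 * sqrt (C * (2 * s))]. *)
suff h : 8192 * C * expR (2 * - gam k) <= 1.
  rewrite -[leRHS]mul1r; apply: le_trans (ler_wpM2r (ltW e0) h).
  by rewrite le_eqVlt; apply/orP; left; apply/eqP; ring.
rewrite mulrN expRN ler_pdivrMr ?expR_gt0// mul1r.
apply: le_trans (expR_ge1Dx _); apply: (le_trans gC).
by rewrite ler_wpDl// ler_peMl ?ler1n// ltW// gam_gt0.
Qed.

(** * One step of the flow, from the circle of radius [rad k] to the next *)

Definition step_error k : R := 2 / (scale k.+1)%:R + 3 * expR (- 3 * gam k).

Lemma step_error_ge0 k : 0 <= step_error k.
Proof.
by apply: addr_ge0; [apply: divr_ge0; rewrite ?(ltW (scale_gt0 _))|rewrite mulr_ge0 ?expR_ge0].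
Qed.

(** At a retained point [expR (- 4 * gam k)] is at most [expR (- 3 * gam k) * A], so additive errors
    become relative ones. The [3] in [step_error] counts two from [trunc_step] and one from the
    regularization of the logarithm. *)
Lemma log_bad k (A B : R) : 0 < A -> expR (- gam k) < A -> 0 <= B ->
  B <= (1 + 2 / (scale k.+1)%:R) * A + 2 * expR (- 4 * gam k) ->
  ln (B + expR (- 4 * gam k)) <= ln A + step_error k.
Proof.
move=> A0 EA B0 hB; have E4 := expR_gt0 (- 4 * gam k).
apply: (@le_trans _ _ (ln (A * (1 + step_error k)))).
  rewrite ler_ln ?posrE ?ltr_wpDl//; last first.
    by rewrite mulr_gt0// ltr_wpDr// step_error_ge0.
  have h : expR (- 4 * gam k) <= expR (- 3 * gam k) * A.
    have -> : - 4 * gam k = - 3 * gam k + - gam k by ring.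
    by rewrite expRD ler_wpM2l ?expR_ge0// ltW.
  rewrite /step_error; move: hB h.
  by move: (expR (- 4 * gam k)) (expR (- 3 * gam k)) (2 / _) => *; lra.
have se0 := step_error_ge0 k.
rewrite lnM ?posrE//; last by rewrite ltr_wpDr.
by rewrite lerD2l le_ln1Dx// (lt_le_trans _ se0)// ltrN10.
Qed.

(** The bound adds up to at most [9 / 2] times [expR (- gam k)], and [5 <= expR 4]. *)
Lemma log_good k (A B : R) : 0 <= A -> A <= expR (- gam k) -> 0 <= B ->
  B <= (1 + 2 / (scale k.+1)%:R) * A + 2 * expR (- 4 * gam k) ->
  ln (B + expR (- 4 * gam k)) <= - gam k + 4.
Proof.
move=> A0 AE B0 hB; have E4 := expR_gt0 (- 4 * gam k).
rewrite -[leRHS]expRK ler_ln ?posrE ?ltr_wpDl ?expR_gt0//.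
rewrite expRD; have e4 : 5 <= expR 4 :> R by apply: le_trans (expR_ge1Dx _); lra.
have h : expR (- 4 * gam k) <= expR (- gam k).
  by rewrite ler_expR; have := gam_gt0 k; lra.
have E1 := expR_gt0 (- gam k).
have x4 := scaleV_le k.+1.
have xA : (1 + 2 / (scale k.+1)%:R) * A <= (3 / 2) * expR (- gam k).
  have x0 : 0 <= 2 / (scale k.+1)%:R :> R by apply: divr_ge0; rewrite ?(ltW (scale_gt0 _)).
  apply: ler_pM; rewrite ?addr_ge0//.
  by move: x4; move: (_^-1) => u; lra.
apply: (@le_trans _ _ (expR (- gam k) * 5)); last by rewrite ler_wpM2l// ltW.
by move: xA hB h E1; move: (expR (- gam k)) (expR _) => *; lra.
Qed.

(** What step [k] asks of the grid size, uniformly in the rotation and in the distribution [f], so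
    that [N] can be fixed before either is known. Dividing by [rad k.+1] rescales the target circle
    to the unit circle. Positivity of the modulus where [f] charges makes [ln] a true logarithm
    there. *)
Definition step_ok k L N : Prop :=
  (forall th (z : R[i]), normc z = rad k ->
    `|(\sum_(j < N) poisson (z / (rad k.+1)%:C) (grid th N j)) / N%:R - 1| <= (b k)^-1) /\
  forall (th : R) (I : finType) (z : I -> R[i]) (f : I -> R),
  (forall i, normc (z i) = rad k) -> (forall i, 0 <= f i) ->
  (forall i, 0 < f i -> 0 < normc (trunc c (scale k) L (z i))) ->
  let g (j : 'I_N) := (\sum_i f i * poisson (z i / (rad k.+1)%:C) (grid th N j)) / N%:R in
  let a (j : 'I_N) := normc (trunc c (scale k.+1) L ((rad k.+1)%:C * grid th N j)) in
  is_true (\sum_i f i * ln (normc (trunc c (scale k) L (z i))) <=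
    \sum_(j | expR (- gam k) < a j) g j * (ln (a j) + step_error k)
    - (gam k - 4) * \sum_(j | ~~ (expR (- gam k) < a j)) g j + (b k)^-1 * \sum_i f i).

Let rho k : R := rad k / rad k.+1.

Let rho_ge0 k : 0 <= rho k.
Proof. by rewrite divr_ge0//; [have := rad_ge k|have := rad_ge k.+1]; lra. Qed.

Let rho_lt1 k : rho k < 1.
Proof. by rewrite ltr_pdivrMr ?mul1r ?rad_lt//; have := rad_ge k.+1; lra. Qed.

Let rad_gt0 k : 0 < rad k.
Proof. by have := rad_ge k; lra. Qed.

Let normc_rho k (z : R[i]) : normc z = rad k -> normc (z / (rad k.+1)%:C) = rho k.
Proof. by move=> zr; rewrite normcM normcV zr normc_real// ltW. Qed.

Lemma eventually_step_ok k L : (kt <= k)%N ->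
  exists N0 : nat, (0 < N0)%N /\ forall N, (N0 <= N)%N -> step_ok k L N.
Proof.
move=> ktk; set r := rad k.+1; set tau := expR (- 4 * gam k).
have r0 : 0 < r := rad_gt0 _.
pose p := \poly_(i < (scale k + L).+1) (c (i%:Z - (scale k)%:Z) * r%:C ^+ i).
have pE w : p.[w] = trunc c (scale k) L (r%:C * w).
  by rewrite horner_poly; apply: eq_bigr => i _; rewrite exprMn mulrA.
have bV : 0 < (b k)^-1 by rewrite invr_gt0.
have rho01 : 0 <= rho k < 1 by rewrite rho_ge0 rho_lt1.
have [N1 [N10 hN1]] := @log_majorant R p tau (rho k) (b k)^-1 (expR_gt0 _) rho01 bV.
have [N2 [N20 hN2]] := @poisson_mean_cvg R (rho k) (b k)^-1 rho01 bV.
exists (maxn N1 N2); split; first by rewrite leq_max N10.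
move=> N; rewrite geq_max => /andP[N1N N2N]; split=> [th z zr|].
  by apply: hN2 => //; rewrite normc_rho.
move=> th I z f zr f0 fpos g a.
have N_gt0 : 0 < N%:R :> R by rewrite ltr0n (leq_trans N10).
pose w i := z i / r%:C.
have wr i : normc (w i) = rho k by exact: normc_rho.
have w1 i : normc (w i) <= 1 by rewrite wr ltW// rho_lt1.
have g0 j : 0 <= g j.
  apply: divr_ge0; last exact: ltW.
  by apply: sumr_ge0 => i _; apply: mulr_ge0 => //; apply: poisson_ge0; exact: w1.
pose v j := ln (normc p.[grid th N j] + tau).
apply: (@le_trans _ _ (\sum_i f i * ((\sum_(j < N) poisson (w i) (grid th N j) * v j) / N%:R
    + (b k)^-1))).
  apply: ler_sum => i _; have [->|fi] := eqVneq (f i) 0; first by rewrite !mul0r.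
  rewrite ler_wpM2l//.
  have Hi : 0 < normc (trunc c (scale k) L (z i)) by apply: fpos; rewrite lt_neqAle eq_sym fi f0.
  rewrite -[leRHS]expRK ler_ln ?posrE ?expR_gt0//.
  have := hN1 N th (w i) N1N; rewrite wr => /(_ (lexx _)); rewrite pE /w mulrC divfK//.
  by rewrite -normc_gt0 normc_real// ltW.
have -> : \sum_i f i * ((\sum_(j < N) poisson (w i) (grid th N j) * v j) / N%:R + (b k)^-1) =
   \sum_j g j * v j + (b k)^-1 * \sum_i f i.
  under eq_bigr do rewrite mulrDr; rewrite big_split/= -mulr_suml [X in _ + X]mulrC.
  congr (_ + _); rewrite /g; under [RHS]eq_bigr do rewrite mulrAC mulr_suml.
  rewrite -[RHS]mulr_suml exchange_big/= mulr_suml; apply: eq_bigr => i _.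
  by rewrite mulrA mulr_sumr; congr (_ / _); apply: eq_bigr => j _; rewrite mulrA.
rewrite lerD2r (bigID (fun j => expR (- gam k) < a j))/=.
have hstep (j : 'I_N) : normc p.[grid th N j] <=
    (1 + 2 / (scale k.+1)%:R) * a j + 2 * expR (- 4 * gam k).
  rewrite pE; apply: trunc_step => //.
  by rewrite normcM normc_real ?(ltW r0)// normc_grid mulr1.
apply: lerD.
  apply: ler_sum => j bj; rewrite ler_wpM2l//; apply: log_bad => //.
  - exact: lt_trans (expR_gt0 _) bj.
  - exact: normc_ge0.
rewrite mulr_sumr -sumrN; apply: ler_sum => j; rewrite -leNgt => bj.
rewrite -mulNr [leRHS]mulrC ler_wpM2l// opprB addrC; apply: (@log_good k (a j)) => //.
- exact: normc_ge0.
- exact: normc_ge0.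
Qed.

(** Makes [Lam * 2 ^+ k] a bound for [ln |H_(k+1)|] on its circle: the modulus is at most
    [Cc * scale k.+2], and [ln (scale k.+2) = 4 * 2 ^ k * ln 4]. *)
Let Lam : R := ln Cc + 16.
Let loss k : R := 33 * Lam / b k.

Let Lam_ge : 16 <= Lam.
Proof. by rewrite lerDr ln_ge0. Qed.

Let loss_gt0 k : 0 < loss k.
Proof. by rewrite divr_gt0// mulr_gt0//; have := Lam_ge; lra. Qed.

Lemma ln_trunc_le k L z : normc z = rad k.+1 -> 0 < normc (trunc c (scale k.+1) L z) ->
  ln (normc (trunc c (scale k.+1) L z)) <= Lam * 2 ^+ k.
Proof.
move=> zr H0; have CC := Cc1.
apply: (@le_trans _ _ (ln (Cc * (scale k.+2)%:R))).
  rewrite ler_ln ?posrE//; last by rewrite mulr_gt0 ?scale_gt0//; lra.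
  apply: le_trans (trunc_bound _ _ c_bd _) _; first by rewrite zr rad_lt1.
  by rewrite zr /rad subKr invrK.
rewrite lnM ?posrE ?scale_gt0//; last by lra.
have t1 : 1 <= 2 ^+ k :> R by rewrite exprn_ege1// ler1n.
rewrite /Lam mulrDl lerD//.
  by rewrite ler_peMr// ln_ge0.
have -> : (scale k.+2)%:R = 4 ^+ (4 * 2 ^ k) :> R.
  by rewrite natrX /scale !expnS mulnA.
rewrite lnXn// -[ln 4 *+ _]mulr_natl natrM natrX.
have : ln 4 <= 4 :> R by apply: ltW; exact: ln_sublinear.
have l0 : 0 <= ln 4 :> R by rewrite ln_ge0// ler1n.
by move: t1; move: (2 ^+ k) (ln 4) l0 => *; nra.
Qed.

Lemma step_error_le k : step_error k <= 17 / b k.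
Proof.
have bk := b_gt0 k; have t0 : 0 < 2 ^+ k :> R by rewrite exprn_gt0.
have t1 : 1 <= 2 ^+ k :> R by rewrite exprn_ege1// ler1n.
have h1 : 2 / (scale k.+1)%:R <= 1 / b k.
  rewrite ler_pdivrMr ?scale_gt0// mulrAC ler_pdivlMr// mul1r.
  apply: (@le_trans _ _ (2 * 2 ^+ k)); first by rewrite ler_wpM2l// b_le.
  by rewrite -exprS -natrX ler_nat ltnW// scale_gt.
have h2 : 3 * expR (- 3 * gam k) <= 16 / b k.
  have gk := gam_gt0 k.
  apply: (@le_trans _ _ (3 * (3 * gam k)^-1)).
    rewrite ler_wpM2l// mulNr expRN lef_pV2 ?posrE ?expR_gt0 ?mulr_gt0//.
    by apply: le_trans (expR_ge1Dx _); lra.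
  rewrite invfM mulrA divff// mul1r /gam invf_div ler_wpM2l// lef_pV2 ?posrE ?mulr_gt0//.
  by rewrite ler_peMr// ltW.
by rewrite /step_error; lra.
Qed.

(** [q], [q'], [p'] are the initial, retained and discarded masses, [I0] and [I'] the integrals of
    the logarithm, [s] the accumulated loss, [v = 1 / b k], [t = 2 ^ k], [g = gam k]. *)
Let core_arith (q q' p' I0 I' s x v t g se : R) : 0 < v -> x = 33 * Lam * v ->
  1 <= t -> g * v = t / 16 -> 8 <= g -> 0 <= s -> s + x <= 1 / 16 ->
  0 <= q' -> 0 <= p' -> q <= 1 + 2 * s -> 1 - 4 * s <= q -> 1 - 4 * s <= I0 ->
  `|q' + p' - q| <= v * q -> I0 <= I' + se * q' - (g - 4) * p' + v * q ->
  I' <= Lam * t * q' -> 0 <= se <= 17 * v ->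
  [/\ q' <= 1 + 2 * (s + x), 1 - 4 * (s + x) <= q' & 1 - 4 * (s + x) <= I'].
Proof.
move: Lam_ge; move: Lam => La L16 v0 xE t1 gv g8 s0 sx q'0 p'0 q1 q2 I1.
rewrite ler_norml => /andP[hm1 hm2] hI I'le /andP[se0 se1].
have lossb : 528 * v <= x by rewrite xE ler_wpM2r ?(ltW v0)//; lra.
have bq : v * q <= 2 * v by rewrite mulrC ler_wpM2r ?(ltW v0)//; lra.
have q'2 : q' <= 1 + 2 * (s + x) by lra.
have eq' : se * q' <= 34 * v.
  by apply: (@le_trans _ _ (17 * v * 2)); [apply: ler_pM => //; lra|lra].
have gp : 0 <= (g - 4) * p' by rewrite mulr_ge0//; lra.
(* The integral starts above [3 / 4], which covers the small errors, so
   [(g - 4) * p' <= Lam * t * q']. With [g - 4 >= g / 2] and [g * v = t / 16] this gives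
   [p' <= 32 * Lam * v * q']. *)
have p'le : p' <= x * q'.
  have h1 : (g - 4) * p' <= La * t * q' by lra.
  have h2 : g / 2 * p' <= (g - 4) * p' by rewrite ler_wpM2r//; lra.
  have h3 : t / 16 * (p' / 2) <= La * t * q' * v.
    by rewrite -gv mulrAC ler_wpM2r ?(ltW v0)// mulrA mulrAC; exact: le_trans h2 h1.
  have t0 : 0 < t by lra.
  have h4 : p' <= 32 * La * q' * v.
    rewrite -(ler_pM2l t0).
    have -> : t * (32 * La * q' * v) = 32 * (La * t * q' * v) by ring.
    by move: h3; move: (La * t * q' * v) => u; lra.
  apply: (le_trans h4); rewrite xE.
  have -> : 32 * La * q' * v = 32 * La * v * q' by ring.
  by rewrite ler_wpM2r// ler_wpM2r ?(ltW v0)//; lra.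
have x0 : 0 <= x by lra.
have lq : x * q' <= x * 2 by rewrite ler_wpM2l//; lra.
by split; lra.
Qed.

(** The witness [f'] is the mass swept onto the next circle by Poisson kernels, restricted to the
    points where the modulus exceeds [expR (- gam k)]. *)
Lemma core_step k L N (th : R) (I : finType) (z : I -> R[i]) (f : I -> R) (s : R) :
  step_ok k L N -> 8 <= gam k -> 0 <= s -> s + loss k <= 1 / 16 ->
  (forall i, normc (z i) = rad k) -> (forall i, 0 <= f i) ->
  (forall i, 0 < f i -> 0 < normc (trunc c (scale k) L (z i))) ->
  \sum_i f i <= 1 + 2 * s -> 1 - 4 * s <= \sum_i f i ->
  1 - 4 * s <= \sum_i f i * ln (normc (trunc c (scale k) L (z i))) ->
  let a (j : 'I_N) := normc (trunc c (scale k.+1) L ((rad k.+1)%:C * grid th N j)) in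
  exists f' : 'I_N -> R, [/\
    forall j, 0 <= f' j <=
      (\sum_i f i * poisson (z i / (rad k.+1)%:C) (grid th N j)) / N%:R,
    forall j, 0 < f' j -> expR (- gam k) < a j,
    \sum_j f' j <= 1 + 2 * (s + loss k),
    1 - 4 * (s + loss k) <= \sum_j f' j &
    1 - 4 * (s + loss k) <= \sum_j f' j * ln (a j)].
Proof.
move=> ok g8 s0 sx zr f0 fpos q1 q2 I1 a.
pose g (j : 'I_N) := (\sum_i f i * poisson (z i / (rad k.+1)%:C) (grid th N j)) / N%:R.
have [okm okI] := ok.
have hI : \sum_i f i * ln (normc (trunc c (scale k) L (z i))) <=
    \sum_(j | expR (- gam k) < a j) g j * (ln (a j) + step_error k)
    - (gam k - 4) * \sum_(j | ~~ (expR (- gam k) < a j)) g j + (b k)^-1 * \sum_i f i.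
  exact: okI th I z f zr f0 fpos.
have hmass : `|\sum_j g j - \sum_i f i| <= (b k)^-1 * \sum_i f i.
  have -> : \sum_j g j - \sum_i f i = \sum_i f i *
      ((\sum_(j < N) poisson (z i / (rad k.+1)%:C) (grid th N j)) / N%:R - 1).
    rewrite /g -mulr_suml exchange_big/= mulr_suml -sumrB; apply: eq_bigr => i _.
    by rewrite -mulr_sumr mulrBr mulr1 mulrA.
  apply: le_trans (ler_norm_sum _ _ _) _; rewrite mulr_sumr; apply: ler_sum => i _.
  by rewrite normrM ger0_norm// mulrC ler_wpM2r// okm.
have g0 j : 0 <= g j.
  apply: divr_ge0 => //; apply: sumr_ge0 => i _; rewrite mulr_ge0// poisson_ge0//.
  by rewrite normc_rho// ltW// rho_lt1.
pose bad j := expR (- gam k) < a j.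
pose f' j := if bad j then g j else 0.
have f'E F : \sum_j f' j * F j = \sum_(j | bad j) g j * F j.
  rewrite [RHS]big_mkcond/=; apply: eq_bigr => j _.
  by rewrite /f'; case: ifP => // _; rewrite mul0r.
have f'S : \sum_j f' j = \sum_(j | bad j) g j by rewrite [RHS]big_mkcond.
pose p' := \sum_(j | ~~ bad j) g j.
have p'0 : 0 <= p' by apply: sumr_ge0.
have q'0 : 0 <= \sum_j f' j by rewrite f'S; apply: sumr_ge0.
have gS : \sum_j g j = \sum_j f' j + p' by rewrite (bigID bad)/= f'S.
have I'le : \sum_j f' j * ln (a j) <= Lam * 2 ^+ k * \sum_j f' j.
  rewrite f'S f'E mulr_sumr; apply: ler_sum => j bj; rewrite mulrC ler_wpM2r//.
  apply: ln_trunc_le; last exact: lt_trans (expR_gt0 _) bj.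
  by rewrite normcM normc_real ?(ltW (rad_gt0 _))// normc_grid mulr1.
have {}hI : \sum_i f i * ln (normc (trunc c (scale k) L (z i))) <=
    \sum_j f' j * ln (a j) + step_error k * \sum_j f' j - (gam k - 4) * p' +
    (b k)^-1 * \sum_i f i.
  apply: (le_trans hI); rewrite lerD2r lerD2r f'S f'E mulr_sumr -big_split/=.
  by apply: ler_sum => j _; rewrite mulrDr [step_error k * _]mulrC.
exists f'.
have [] := @core_arith (\sum_i f i) (\sum_j f' j) p'
  (\sum_i f i * ln (normc (trunc c (scale k) L (z i)))) (\sum_j f' j * ln (a j))
  s (loss k) (b k)^-1 (2 ^+ k) (gam k) (step_error k) => //.
- by rewrite invr_gt0.
- by rewrite exprn_ege1// ler1n.
- by rewrite /gam; field; exact: lt0r_neq0.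
- by rewrite -gS.
- by rewrite step_error_le step_error_ge0.
move=> h1 h2 h3; split=> //.
- by move=> j; rewrite /f'; case: ifP => _; rewrite ?lexx ?g0//.
- by move=> j; rewrite /f'; case: ifP => // _; rewrite ltxx.
Qed.

(** * Iterating the flow *)

Let total_loss k0 k : R := \sum_(k0 <= j < k) loss j.

Lemma uniform_step_ok L k0 K : (kt <= k0)%N ->
  exists N0 : nat, (0 < N0)%N /\ forall N k, (N0 <= N)%N -> (k0 <= k < k0 + K)%N -> step_ok k L N.
Proof.
move=> ktk0; elim: K => [|K [N0 [N00 IH]]].
  by exists 1%N; split=> // N k _ /andP[h]; rewrite addn0 ltnNge h.
have [N1 [N10 hN1]] := eventually_step_ok L (leq_trans ktk0 (leq_addr K k0)).
exists (maxn N0 N1); split; first by rewrite leq_max N00.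
move=> N k; rewrite geq_max => /andP[N0N N1N] /andP[kk]; rewrite addnS ltnS leq_eqVlt.
by move=> /predU1P[->|kK]; [exact: hN1|apply: IH; rewrite // kk].
Qed.

(* The mass left after step [k] of the flow started on level [k0]. *)
Definition mass_at k0 k L N (th A : R) : Prop :=
  exists f : 'I_N -> R, [/\
    forall l, 0 <= f l <= A / N%:R * (1 + 2 * total_loss k0 k.+1),
    forall l, 0 < f l -> expR (- gam k) <
      normc (trunc c (scale k.+1) L ((rad k.+1)%:C * grid th N l)),
    \sum_l f l <= 1 + 2 * total_loss k0 k.+1,
    1 - 4 * total_loss k0 k.+1 <= \sum_l f l &
    1 - 4 * total_loss k0 k.+1 <=
      \sum_l f l * ln (normc (trunc c (scale k.+1) L ((rad k.+1)%:C * grid th N l)))].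

(** Unit mass at [z], where the logarithm exceeds [1]. The density constant bounds the kernel at
    modulus [rho], as [(1 - rho ^ 2) / (1 - rho) ^ 2 <= 2 / (1 - rho)]. *)
Lemma mass_first k L N (th : R) z : step_ok k L N -> 8 <= gam k -> loss k <= 1 / 16 ->
  normc z = rad k -> expR 1 < normc (trunc c (scale k) L z) ->
  mass_at k k L N th (2 / (1 - rho k)).
Proof.
move=> ok g8 lk zr Hz.
have H0 : 0 < normc (trunc c (scale k) L z) := lt_trans (expR_gt0 _) Hz.
have tl : total_loss k k.+1 = loss k by rewrite /total_loss big_nat1.
have [||||f [fg fb fq1 fq2 fI]] := @core_step k L N th 'I_1 (fun=> z) (fun=> 1) 0 ok g8 (lexx _)
  _ (fun=> zr) (fun=> ler01) (fun _ _ => H0).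
- by rewrite add0r.
- by rewrite big_ord1 mulr0 addr0.
- by rewrite big_ord1 mulr0 subr0.
- rewrite big_ord1 mulr0 subr0 mul1r -(@expRK R 1) ler_ln ?posrE ?expR_gt0//.
  exact: ltW.
exists f; rewrite tl -[loss k]add0r; split=> // l.
have /andP[-> /= fl] := fg l; apply: (le_trans fl); rewrite big_ord1 mul1r.
have r1 : 0 < 1 - rho k by rewrite subr_gt0 rho_lt1.
have l0 : 0 <= 2 * (0 + loss k) by rewrite add0r mulr_ge0// ltW.
have P : poisson (z / (rad k.+1)%:C) (grid th N l) <= 2 / (1 - rho k).
  rewrite /poisson normc_rho//.
  have h : 1 - rho k <= normc (grid th N l - z / (rad k.+1)%:C).
    by apply: le_trans (lerB_normc _ _); rewrite normc_grid normc_rho.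
  rewrite ler_pdivrMr; last by rewrite exprn_gt0// (lt_le_trans r1).
  apply: (@le_trans _ _ (2 / (1 - rho k) * (1 - rho k) ^+ 2)).
    have -> : 2 / (1 - rho k) * (1 - rho k) ^+ 2 = 2 * (1 - rho k).
      by field; exact: lt0r_neq0.
    have := rho_ge0 k; have := rho_lt1 k; move: (rho k) => x; nra.
  rewrite ler_wpM2l ?divr_ge0 ?(ltW r1)//.
  by rewrite lerXn2r ?nnegrE ?(ltW r1)// normc_ge0.
apply: (@le_trans _ _ (2 / (1 - rho k) / N%:R)).
  by rewrite ler_wpM2r ?invr_ge0.
by rewrite ler_peMr ?lerDl// divr_ge0// divr_ge0// ltW.
Qed.

(** The density hardly grows. By [poissonC] the sum of the kernels over all sources for one target
    equals a sum over all targets for one source, so each step multiplies the bound by at most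
    [1 + (b k.+1)^-1]. *)
Lemma mass_next k0 k L N (th A : R) : (0 < N)%N -> 0 <= A -> (k0 <= k)%N ->
  step_ok k.+1 L N -> 8 <= gam k.+1 -> total_loss k0 k.+2 <= 1 / 16 ->
  mass_at k0 k L N th A -> mass_at k0 k.+1 L N th A.
Proof.
move=> N0 A0 k0k ok g8 tl [f [fA fb fq1 fq2 fI]].
have N_gt0 : 0 < N%:R :> R by rewrite ltr0n.
have tlS : total_loss k0 k.+2 = total_loss k0 k.+1 + loss k.+1.
  by rewrite /total_loss big_nat_recr//= leqW.
have tl0 j : 0 <= total_loss k0 j by apply: sumr_ge0 => i _; exact: ltW.
have f0 l : 0 <= f l by case/andP: (fA l).
have zr (l : 'I_N) : normc ((rad k.+1)%:C * grid th N l) = rad k.+1.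
  by rewrite normcM normc_real ?(ltW (rad_gt0 _))// normc_grid mulr1.
have [|l /fb|f' [fg' fb' fq1' fq2' fI']] := @core_step k.+1 L N th _
  (fun l : 'I_N => (rad k.+1)%:C * grid th N l) f (total_loss k0 k.+1) ok g8 (tl0 _) _ zr f0 _
  fq1 fq2 fI.
- by rewrite -tlS.
- exact: lt_trans (expR_gt0 _).
have tl8 : total_loss k0 k.+1 <= 1 / 16.
  by apply: le_trans tl; rewrite tlS lerDl ltW.
exists f'; rewrite tlS; split=> // l.
have /andP[-> /= fl] := fg' l; apply: (le_trans fl).
set u := total_loss k0 k.+1 in fA tl8 *; have u0 : 0 <= u := tl0 _.
have rhoE (i : 'I_N) : (rad k.+1)%:C * grid th N i / (rad k.+2)%:C = (rho k.+1)%:C * grid th N i.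
  by rewrite /rho rmorphM/= fmorphV/= mulrAC.
have hk : (\sum_(i < N) poisson ((rho k.+1)%:C * grid th N l) (grid th N i)) / N%:R
    <= 1 + (b k.+1)^-1.
  have [okm _] := ok; have := okm th _ (zr l); rewrite rhoE ler_norml => /andP[_].
  by rewrite lerBlDl.
have bl : (b k.+1)^-1 <= loss k.+1.
  by rewrite /loss ler_peMl ?invr_ge0 ?(ltW (b_gt0 _))//; have := Lam_ge; lra.
apply: (@le_trans _ _ (A / N%:R * (1 + 2 * u) * (1 + loss k.+1))); last first.
  rewrite -mulrA ler_wpM2l ?divr_ge0//; have := loss_gt0 k.+1.
  by move: tl8 u0; move: (loss _) (u) => x y; nra.
apply: (@le_trans _ _ (A / N%:R * (1 + 2 * u) * (1 + (b k.+1)^-1))); last first.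
  rewrite ler_wpM2l//; first by rewrite mulr_ge0 ?divr_ge0// addr_ge0// mulr_ge0.
  by rewrite lerD2l.
apply: (@le_trans _ _ (A / N%:R * (1 + 2 * u) *
  ((\sum_(i < N) poisson ((rho k.+1)%:C * grid th N l) (grid th N i)) / N%:R))); last first.
  by rewrite ler_wpM2l// mulr_ge0 ?divr_ge0// addr_ge0// mulr_ge0.
rewrite mulrA ler_wpM2r ?invr_ge0 ?(ltW N_gt0)// mulr_sumr; apply: ler_sum => i _.
rewrite rhoE poissonC ?normc_grid//.
apply: ler_wpM2r; last by case/andP: (fA i).
by apply: poisson_ge0; rewrite normcM normc_real// normc_grid mulr1 ltW.
Qed.

Lemma small_total_loss : exists ks : nat, forall k0 k, (ks <= k0)%N ->
  total_loss k0 k <= 1 / 16.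
Proof.
have L16 := Lam_ge; have L0 : 0 < 33 * Lam by lra.
have [|ks hks] := b_sum (_ : 0 < 1 / 16 / (33 * Lam)); first by rewrite divr_gt0//; lra.
exists ks => k0 k ksk0; have := hks k0 k ksk0.
by rewrite ler_pdivlMr// mulrC mulr_sumr.
Qed.

(* The mass of [mass_at] stays above [1 / 2], whereas the bad points of a
   high level carry only a small proportion of the grid. *)
Lemma trunc_bounded : exists ks : nat, forall k0, (ks <= k0)%N ->
  exists L0 : nat, forall L z, (L0 <= L)%N -> normc z = rad k0 ->
  normc (trunc c (scale k0) L z) <= expR 1.
Proof.
have [ks hks] := small_total_loss.
have [kg hkg] := gam_unbounded 8.
exists (maxn kt (maxn ks kg)) => k0; rewrite !geq_max => /and3P[ktk0 ksk0 kgk0].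
pose A := 2 / (1 - rho k0).
have A0 : 0 < A by rewrite divr_gt0// subr_gt0 rho_lt1.
(* Chosen so that points of density at most [2 * A / N], in proportion [1 / (8 * A)], carry mass at
   most [1 / 4], less than the [1 / 2] that remains. *)
have [|k1 hk1] := @good_fraction ((8 * A)^-1); first by rewrite invr_gt0 mulr_gt0.
pose K := maxn k0 k1.
have k0K : (k0 <= K)%N by rewrite leq_maxl.
(* Level [K.+1], because the mass after step [K] sits on the circle of radius [rad K.+1]. *)
have [L1 hL1] := hk1 K.+1 (leqW (leq_maxr _ _)).
exists L1 => L z L1L zr; rewrite leNgt; apply/negP => Hz.
have [N1 [N10 hN1]] := hL1 L L1L.
have [N2 [N20 hN2]] := uniform_step_ok L (K.+1 - k0) ktk0.
pose N := maxn N1 N2.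
have N0 : (0 < N)%N by rewrite leq_max N10.
have N_gt0 : 0 < N%:R :> R by rewrite ltr0n.
have [th hth] := hN1 N (leq_maxl _ _).
have ok k : (k0 <= k <= K)%N -> step_ok k L N.
  move=> kK; apply: hN2; first exact: leq_maxr.
  by rewrite subnKC ?ltnS// leqW.
have mass k : (k0 <= k <= K)%N -> mass_at k0 k L N th A.
  move=> /andP[k0k]; rewrite -(subnKC k0k); elim: (k - k0)%N => [_|n IH kK].
    rewrite addn0; apply: (@mass_first k0 L N th z) => //.
    - by apply: ok; rewrite leqnn.
    - exact: hkg.
    - by have := hks k0 k0.+1 ksk0; rewrite /total_loss big_nat1.
  rewrite addnS; apply: mass_next => //.
  - exact: ltW.
  - exact: leq_addr.
  - by apply: ok; rewrite -addnS leq_addr.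
  - by apply: hkg; rewrite -addnS (leq_trans kgk0)// leq_addr.
  - exact: hks.
  - by apply: IH; rewrite (leq_trans _ kK)// addnS.
have [|f [fA fb _ fq _]] := mass K; first by rewrite k0K leqnn.
have tl := hks k0 K.+1 ksk0.
have [tl2 tl4] : 1 + 2 * total_loss k0 K.+1 <= 2 /\ 1 / 2 <= 1 - 4 * total_loss k0 K.+1.
  by move: tl; move: (total_loss _ _) => u; split; lra.
have : \sum_l f l <= (8 * A)^-1 * N%:R * (A / N%:R * 2).
  apply: (@le_trans _ _ (#|[pred l : 'I_N | expR (- gam K.+1) <
      normc (trunc c (scale K.+1) L ((rad K.+1)%:C * grid th N l))]|%:R * (A / N%:R * 2))).
    rewrite -sum1_card natr_sum mulr_suml [leRHS]big_mkcond/=; apply: ler_sum => l _.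
    have /andP[fl0 fl] := fA l; rewrite inE; case: ifPn => [_|].
      rewrite mul1r; apply: (le_trans fl); apply: ler_wpM2l => //.
      by rewrite divr_ge0 ?(ltW A0).
    (* Retained points exceed [expR (- gam K)], which is at least the threshold [expR (- gam K.+1)]
       of [good_fraction]. *)
    rewrite -leNgt => hl; rewrite leNgt; apply/negP => /fb.
    apply/negP; rewrite -leNgt (le_trans hl)// ler_expR lerN2.
    exact: gam_mono.
  by rewrite ler_wpM2r// mulr_ge0// divr_ge0// ltW.
have -> : (8 * A)^-1 * N%:R * (A / N%:R * 2) = 1 / 4.
  by field; rewrite !lt0r_neq0.
by move=> h; have := le_trans tl4 (le_trans fq h); lra.
Qed.

(** * Recovering the coefficients by discrete Fourier inversion *)

Lemma grid_coef N th (d j : nat) (a : nat -> R[i]) (r : R) : (d < N)%N -> (j <= d)%N ->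
  a j * r%:C ^+ j * N%:R =
  \sum_(l < N) (\sum_(i < d.+1) a i * (r%:C * grid th N l) ^+ i) / grid th N l ^+ j.
Proof.
move=> dN jd; under eq_bigr do rewrite mulr_suml.
rewrite exchange_big/= (bigD1 (Ordinal (jd : (j < d.+1)%N)))//= [X in _ + X]big1 ?addr0.
  under eq_bigr => l _.
    rewrite exprMn mulrA mulfK; last by rewrite expf_neq0// grid_neq0.
    over.
  by rewrite sumr_const card_ord mulr_natr.
move=> i ij; have {ij} ij : (i : nat) != j.
  by apply: contra_neq ij => h; apply: val_inj.
have gn l : grid th N l != 0 := grid_neq0 _ _ _.
(* All degrees are below [N], so distinct frequencies are not aliased and the other terms cancel. *)
have iN : (i < N)%N by apply: leq_ltn_trans dN; rewrite -ltnS.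
have jN : (j < N)%N by apply: leq_ltn_trans dN.
have [lt_ij|lt_ji|eq_ij] := ltngtP i j; last by rewrite eq_ij eqxx in ij.
  transitivity (a i * r%:C ^+ i * \sum_(l < N) (grid th N l ^+ (j - i))^-1).
    rewrite mulr_sumr; apply: eq_bigr => l _.
    rewrite exprMn -!mulrA; congr (_ * (_ * _)).
    rewrite -{1}(subnK (ltnW lt_ij)) exprD invfM mulrCA mulfV ?mulr1//.
    by rewrite expf_neq0.
  by rewrite sum_gridV ?mulr0// subn_gt0 lt_ij (leq_ltn_trans (leq_subr _ _)).
transitivity (a i * r%:C ^+ i * \sum_(l < N) grid th N l ^+ (i - j)).
  rewrite mulr_sumr; apply: eq_bigr => l _.
  rewrite exprMn -!mulrA; congr (_ * (_ * _)).
  by rewrite -{1}(subnK (ltnW lt_ji)) exprD mulfK// expf_neq0.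
by rewrite sum_gridX ?mulr0// subn_gt0 lt_ji (leq_ltn_trans (leq_subr _ _)).
Qed.

Lemma shifted_index (n : int) (M L k : nat) : (k.*2.*2 <= M)%N -> (`|n| <= k)%N ->
  (k <= L)%N -> exists j : nat, [/\ j%:Z - M%:Z = n, (j <= M.*2)%N & (j <= M + L)%N].
Proof. by move=> kM nk kL; exists (absz (n + M%:Z)); split; lia. Qed.

Lemma double_le_sqr (j M : nat) : (4 <= M)%N -> (j <= M.*2)%N -> (j * 2 <= M ^ 2)%N.
Proof. by move=> M4 jM; rewrite -mulnn; nia. Qed.

(** Average [H_k] against a character. The exceptional points have proportion [eps / (4 * e)] and
    modulus at most [e]; elsewhere the modulus is at most [expR (- gam k) <= eps / 4]. The factor
    [rad k ^+ j] costs at most [2]. *)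
Lemma coef_small (n : int) (eps : R) : 0 < eps -> normc (c n) <= eps.
Proof.
move=> eps0.
have [ks hks] := trunc_bounded.
have e1 : 0 < expR 1 :> R := expR_gt0 1.
have [|k1 hk1] := @good_fraction (eps / (4 * expR 1)); first by rewrite divr_gt0// mulr_gt0.
have [k2 hk2] := gam_unbounded (4 / eps).
pose k := maxn (maxn ks k1) (maxn k2 `|n|%N).
have [kks kk1 kk2 kn] : [/\ (ks <= k)%N, (k1 <= k)%N, (k2 <= k)%N & (`|n| <= k)%N].
  by rewrite /k !leq_max !leqnn !orbT.
have [L0 hL0] := hks k kks; have [L1 hL1] := hk1 k kk1.
set M := scale k.
have kM : (k.*2.*2 <= M)%N.
  rewrite /M /scale; elim: (k) => [//|j IH].
  rewrite expnS mulnC expnM -mulnn; apply: (@leq_trans (4 ^ (2 ^ j) * 4)%N); last first.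
    rewrite leq_mul2l; apply/orP; right; exact: (scale_ge4 j).
  have : (4 <= 4 ^ (2 ^ j))%N := scale_ge4 j.
  by move: (4 ^ _)%N IH => x; lia.
pose L := maxn (maxn L0 L1) k.
have [N1 [N10 hN1]] := hL1 L (leq_trans (leq_maxr L0 L1) (leq_maxl _ _)).
pose N := maxn N1 (M + L).+1.
have N_gt0 : 0 < N%:R :> R by rewrite ltr0n leq_max N10.
have [th hth] := hN1 N (leq_maxl _ _).
have hb z : normc z = rad k -> normc (trunc c M L z) <= expR 1.
  by apply: hL0; rewrite (leq_trans (leq_maxl L0 L1))// leq_maxl.
have kL : (k <= L)%N by rewrite leq_maxr.
have [j [jE jM jL]] := shifted_index kM kn kL.
have := @grid_coef N th (M + L) j (fun i => c (i%:Z - M%:Z)) (rad k) (leq_maxr _ _) jL.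
rewrite jE => hcoef.
have r0 := rad_gt0 k.
pose a l := normc (trunc c M L ((rad k)%:C * grid th N l)).
have h1 : normc (c n) * rad k ^+ j * N%:R <= \sum_(l < N) a l.
  have -> : normc (c n) * rad k ^+ j * N%:R = normc (c n * (rad k)%:C ^+ j * N%:R).
    rewrite !normcM normcX normc_real ?(ltW r0)//; congr (_ * _).
    by rewrite -(rmorph_nat (real_complex R)) normc_real.
  rewrite hcoef; apply: le_trans (normc_sum _ _ _) _; apply: ler_sum => l _.
  by rewrite normcM normcV normcX normc_grid expr1n invr1 mulr1.
have h2 : \sum_(l < N) a l <= eps / 4 * N%:R + expR (- gam k) * N%:R.
  apply: (@le_trans _ _ (\sum_(l < N) ((if expR (- gam k) < a l then expR 1 else 0)
      + expR (- gam k)))).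
    apply: ler_sum => l _; case: ltP => hl; last by rewrite add0r.
    rewrite ler_wpDr ?expR_ge0//; apply: hb.
    by rewrite normcM normc_real ?(ltW r0)// normc_grid mulr1.
  rewrite big_split/= sumr_const card_ord -(mulr_natr (expR (- gam k))) lerD2r.
  rewrite -big_mkcond/= sumr_const -(mulr_natl (expR 1)).
  apply: le_trans (ler_wpM2r (ltW e1) hth) _.
  by rewrite le_eqVlt; apply/orP; left; apply/eqP; field; exact: lt0r_neq0.
have h3 : expR (- gam k) <= eps / 4.
  rewrite expRN -[eps / 4]invf_div lef_pV2 ?posrE ?expR_gt0 ?divr_gt0//.
  by apply: le_trans (expR_ge1Dx _); rewrite ler_wpDl// hk2.
(* Bernoulli's inequality: [j] is at most [2 * M], while [scale k.+1 = M ^ 2] and [M >= 4]. *)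
have h4 : 1 / 2 <= rad k ^+ j.
  have x01 : 0 <= ((scale k.+1)%:R^-1 : R) <= 1.
    by rewrite invr_ge0 (ltW (scale_gt0 _)) (le_trans (scaleV_le _))// ler_pdivrMr// mul1r ler1n.
  apply: le_trans (bernoulli_le j x01).
  suff : j%:R * (scale k.+1)%:R^-1 <= 1 / 2 :> R by move: (j%:R * _) => u; lra.
  rewrite ler_pdivrMr ?scale_gt0// mulrAC ler_pdivlMr// mul1r -natrM ler_nat scaleS -/M.
  exact: double_le_sqr (scale_ge4 k) jM.
have {}h1 : normc (c n) * rad k ^+ j <= eps / 2.
  rewrite -(ler_pM2r N_gt0); apply: (le_trans h1); apply: (le_trans h2).
  by rewrite -mulrDl ler_wpM2r ?(ltW N_gt0)//; move: h3; move: (expR _) => u; lra.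
have c0 := normc_ge0 (c n).
have : normc (c n) * (1 / 2) <= normc (c n) * rad k ^+ j by rewrite ler_wpM2l.
by move: h1; move: (_ * rad k ^+ j) => u; lra.
Qed.

Lemma coef_eq0 (n : int) : c n = 0.
Proof.
apply/eqP; rewrite -normc_eq0 eq_le normc_ge0 andbT; apply/ler_addgt0Pl => e e0.
by rewrite addr0 coef_small.
Qed.

End Core.

(** * Condensation and decay of the coefficients *)

Section Condensation.
Variables (R : realType) (omega : R -> R).
Hypothesis omega_pos : forall t : R, 0 < t -> 0 < omega t.
Hypothesis omega_incr : forall s t : R, 0 < s -> s <= t -> omega s / s <= omega t / t.
Hypothesis omega_sum : cvgn (series (fun n : nat => (omega n.+1%:R)^-1 : R)).

Lemma omega_mono s t : 0 < s -> s <= t -> omega s <= omega t.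
Proof.
move=> s0 st; have t0 := lt_le_trans s0 st.
have := omega_incr s0 st; rewrite ler_pdivrMr// => /le_trans; apply.
by rewrite mulrAC ler_pdivrMr// ler_wpM2l// ltW// omega_pos.
Qed.

Lemma omega_tail e : 0 < e -> exists n1 : nat, forall p q, (n1 <= p)%N ->
  \sum_(p <= i < q) (omega i.+1%:R)^-1 <= e.
Proof.
move=> e0; set u := fun n : nat => (omega n.+1%:R)^-1 : R.
have u0 n : 0 <= u n by rewrite invr_ge0 ltW// omega_pos// ltr0n.
have nd : nondecreasing_seq (series u).
  by apply/nondecreasing_seqP => n; rewrite /series/= big_nat_recr//= lerDl.
have /cvgrPdist_le/(_ _ e0)[n1 _ h] := omega_sum.
exists n1 => p q n1p; have [pq|qp] := leqP p q; last by rewrite big_geq ?ltW// ltnW.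
have le_l : series u q <= limn (series u) by exact: nondecreasing_cvgn_le.
have := h p n1p; rewrite ler_norml => /andP[_ hp].
have E : series u q = series u p + \sum_(p <= i < q) u i.
  by rewrite /series/= (@big_cat_nat _ _ _ p).
by move: hp le_l; rewrite E; lra.
Qed.

(** The sequence [b_k]. The cap [2 ^+ k] provides the upper bound on [b] assumed for the flow, and
    adds only a geometric series to the sum of inverses. *)
Definition growth k : R := Num.min (omega (2 ^+ k) / 2 ^+ k) (2 ^+ k).

Let two_gt0 k : 0 < 2 ^+ k :> R.
Proof. exact: exprn_gt0. Qed.

Lemma growth_gt0 k : 0 < growth k.
Proof. by rewrite lt_min two_gt0 divr_gt0// omega_pos. Qed.

Lemma growth_le k : growth k <= 2 ^+ k.
Proof. by rewrite ge_min lexx orbT. Qed.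

Lemma growth_mono k : growth k <= growth k.+1.
Proof.
have t : 2 ^+ k <= 2 ^+ k.+1 :> R by rewrite ler_weXn2l// ler1n.
by rewrite le_min !ge_min (omega_incr (two_gt0 k) t) t orbT.
Qed.

(** Cauchy condensation: the block has [2 ^ k] terms, each at least the last one because [omega] is
    monotone. *)
Lemma condensation_block k :
  2 ^+ k.+1 / omega (2 ^+ k.+1) <= 2 * \sum_(2 ^ k <= i < 2 ^ k.+1) (omega i.+1%:R)^-1.
Proof.
apply: (@le_trans _ _ (2 * \sum_(2 ^ k <= i < 2 ^ k.+1) (omega (2 ^+ k.+1))^-1)).
  rewrite sumr_const_nat expnS mul2n -addnn addnK exprS -mulrA ler_wpM2l//.
  by rewrite -(mulr_natl (omega _)^-1) natrX.
rewrite ler_wpM2l// big_nat_cond [leRHS]big_nat_cond; apply: ler_sum => i /andP[/andP[_ ik] _].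
rewrite lef_pV2 ?posrE ?omega_pos ?ltr0n//; apply: omega_mono; first by rewrite ltr0n.
by rewrite -natrX ler_nat.
Qed.

Lemma condensation n m : \sum_(n.+1 <= k < m.+1) 2 ^+ k / omega (2 ^+ k) <=
  2 * \sum_(2 ^ n <= i < 2 ^ m) (omega i.+1%:R)^-1.
Proof.
have [nm|mn] := leqP n m; last first.
  rewrite big_geq ?ltnS ?(ltnW mn)// mulr_ge0// sumr_ge0// => i _.
  by rewrite invr_ge0 ltW// omega_pos// ltr0n.
elim: m nm => [|m IH]; first by rewrite leqn0 => /eqP ->; rewrite !big_geq// mulr0.
rewrite leq_eqVlt => /predU1P[->|]; first by rewrite !big_geq// mulr0.
rewrite ltnS => nm; rewrite big_nat_recr//=.
rewrite [X in _ <= 2 * X](@big_cat_nat _ _ _ (2 ^ m)) ?leq_exp2l//= mulrDr lerD//; first exact: IH.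
exact: condensation_block.
Qed.

Lemma sum_half_expn n m : \sum_(n <= k < m) (2 ^+ k)^-1 <= 2 / 2 ^+ n :> R.
Proof.
have [nm|mn] := leqP n m; last by rewrite big_geq ?divr_ge0// ltnW.
suff -> : \sum_(n <= k < m) (2 ^+ k)^-1 = 2 / 2 ^+ n - 2 / 2 ^+ m :> R.
  by rewrite lerBlDr lerDl divr_ge0.
elim: m nm => [|m IH]; first by rewrite leqn0 => /eqP ->; rewrite big_geq// subrr.
rewrite leq_eqVlt => /predU1P[->|]; first by rewrite big_geq// subrr.
rewrite ltnS => nm; rewrite big_nat_recr//= IH// exprS.
by field; rewrite !expf_neq0.
Qed.

Lemma growth_sum e : 0 < e -> exists k1 : nat, forall n m, (k1 <= n)%N ->
  \sum_(n <= j < m) (growth j)^-1 <= e.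
Proof.
move=> e0; have e4 : 0 < e / 4 by rewrite divr_gt0.
have [n1 hn1] := omega_tail e4.
have [n2 hn2] : exists n2 : nat, 4 / e <= n2%:R.
  by exists (Num.truncn (4 / e)).+1; rewrite ltW// truncnS_gt.
exists (maxn n1 n2).+1 => n m; case: n => // n; rewrite ltnS geq_max => /andP[n1n n2n].
case: m => [|m]; first by rewrite big_geq ?ltW.
apply: (@le_trans _ _ (\sum_(n.+1 <= j < m.+1) (2 ^+ j / omega (2 ^+ j) + (2 ^+ j)^-1))).
  apply: ler_sum => j _; rewrite /growth.
  have h1 : 0 <= 2 ^+ j / omega (2 ^+ j) by rewrite divr_ge0 ?ltW// omega_pos.
  have h2 : 0 <= (2 ^+ j)^-1 :> R by rewrite invr_ge0 ltW.
  by rewrite minEle; case: ifP => _; rewrite ?invf_div ?lerDl ?lerDr.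
rewrite big_split/=.
have h1 : \sum_(n.+1 <= j < m.+1) 2 ^+ j / omega (2 ^+ j) <= e / 2.
  apply: (le_trans (condensation n m)).
  have : \sum_(2 ^ n <= i < 2 ^ m) (omega i.+1%:R)^-1 <= e / 4.
    by apply: hn1; rewrite (leq_trans n1n)// ltnW// ltn_expl.
  by move: (\sum_(_ <= i < _) _) => u; lra.
have h2 : \sum_(n.+1 <= j < m.+1) (2 ^+ j)^-1 <= e / 2 :> R.
  apply: (le_trans (sum_half_expn _ _)); rewrite exprS invfM mulrA divff// mul1r.
  have t : 4 / e <= 2 ^+ n.
    by apply: le_trans hn2 _; rewrite -natrX ler_nat (leq_trans n2n)// ltnW// ltn_expl.
  apply: (@le_trans _ _ (e / 4)); last by lra.
  by rewrite -[e / 4]invf_div lef_pV2 ?posrE ?divr_gt0.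
by lra.
Qed.

Lemma ln4_ge1 : 1 <= ln 4 :> R.
Proof.
rewrite -[leLHS](@expRK R) ler_ln ?posrE ?expR_gt0//.
(* [exp (- 1 / 2) >= 1 / 2] gives [exp (1 / 2) <= 2], hence [e <= 4]. *)
have h : 1 / 2 <= expR (- (1 / 2)) :> R by apply: le_trans (expR_ge1Dx _); lra.
have e : expR (1 / 2) <= 2 :> R.
  rewrite -[expR _]invrK -expRN -[leRHS]invrK lef_pV2 ?posrE ?invr_gt0 ?expR_gt0//.
  by move: h; rewrite div1r.
have -> : expR 1 = expR (1 / 2) * expR (1 / 2) :> R.
  by rewrite -expRD; congr expR; field.
have := ler_pM (expR_ge0 _) (expR_ge0 _) e e => /le_trans; apply.
by rewrite -natrM.
Qed.

Lemma two_expn_le_ln k (n : nat) : (scale k <= n)%N -> 2 ^+ k <= ln n%:R :> R.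
Proof.
move=> kn; apply: (@le_trans _ _ (ln (scale k)%:R)).
  rewrite /scale natrX lnXn// -[ln 4 *+ _]mulr_natl natrX.
  by rewrite ler_peMr ?ln4_ge1// ltW.
by rewrite ler_ln ?posrE ?scale_gt0 ?ler_nat// (lt_le_trans (scale_gt0 R k))// ler_nat.
Qed.

Lemma growth_decay k (n : nat) : (scale k <= n)%N -> growth k * ln n%:R <= omega (ln n%:R).
Proof.
move=> /two_expn_le_ln ln2; have l0 := lt_le_trans (two_gt0 k) ln2.
rewrite -ler_pdivlMr//; apply: le_trans (omega_incr (two_gt0 k) ln2).
by rewrite ge_min lexx.
Qed.

End Condensation.

(** * Boundedness of the coefficients *)

Section Coefficients.
Variables (R : realType) (c : int -> R[i]).

Lemma sum_sqrV_le M N : (0 < M)%N -> \sum_(M.+1 <= n < N.+1) (n%:R ^+ 2)^-1 <= 1 :> R.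
Proof.
move=> M0; have [MN|NM] := leqP M N; last by rewrite big_geq// ltnS ltnW.
apply: (@le_trans _ _ (M%:R^-1 - N%:R^-1)); last first.
  apply: (@le_trans _ _ (M%:R^-1)); first by rewrite lerBlDr lerDl invr_ge0.
  by rewrite invf_le1 ?ler1n// ltr0n.
elim: N MN => [|N IH]; first by rewrite leqNgt M0.
rewrite leq_eqVlt => /predU1P[->|]; first by rewrite big_geq// subrr.
rewrite ltnS => MN; rewrite big_nat_recr//=.
have N0 : 0 < N%:R :> R by rewrite ltr0n (leq_trans M0).
apply: le_trans (lerD (IH MN) (lexx _)) _.
have N1 : 0 < N.+1%:R :> R by rewrite ltr0n.
suff : (N.+1%:R ^+ 2)^-1 <= N%:R^-1 - N.+1%:R^-1 :> R.
  by move: ((N.+1%:R ^+ 2)^-1) (N%:R^-1) (N.+1%:R^-1) (M%:R^-1) => u v w x; lra.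
have -> : N%:R^-1 - N.+1%:R^-1 = (N%:R * N.+1%:R)^-1 :> R.
  by rewrite -(natr1 N); field; rewrite natr1 !lt0r_neq0.
by rewrite lef_pV2 ?posrE ?exprn_gt0 ?mulr_gt0// expr2 ler_wpM2r ?ltW// ltr_nat.
Qed.

(** One point of convergence suffices. Consecutive symmetric sums differ by the two terms of
    frequencies [n] and [- n], and the negative coefficients are already bounded. *)
Lemma coef_bounded (C2 t : R) : (forall N, neg_tail c 0 N <= C2) ->
  sym_sums_to_zero c t -> exists2 C, 1 <= C & forall n, normc (c n) <= C.
Proof.
move=> hC2 ht; have [N0 hN0] := ht 1 ltr01.
have cneg n : normc (c (- n.+1%:Z)) <= C2.
  apply: le_trans (hC2 n.+1); rewrite /neg_tail big_nat_recr//= lerDr.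
  by apply: sumr_ge0 => i _; exact: normc_ge0.
have C20 : 0 <= C2 := le_trans (normc_ge0 _) (cneg 0%N).
pose S := \sum_(0 <= i < N0.+1) normc (c i%:Z).
have S0 : 0 <= S by apply: sumr_ge0 => i _; exact: normc_ge0.
exists (S + C2 + 2); first by lra.
case=> n; last by rewrite NegzE; apply: le_trans (cneg n) _; lra.
have [nN|Nn] := leqP n N0.
  apply: (@le_trans _ _ S); last by lra.
  rewrite /S (bigD1_seq n) ?mem_index_iota ?iota_uniq//= lerDl.
  by apply: sumr_ge0 => i _; exact: normc_ge0.
case: n Nn => // n; rewrite ltnS => Nn.
have h1 := hN0 _ Nn; have h2 := hN0 _ (leqW Nn).
move: h1 h2; rewrite !ltr_normcE !normc_sym_partial_sum.
set xi := expi t; set T := trunc c n n xi => h1 h2.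
have E : trunc c n.+1 n.+1 xi = c (- n.+1%:Z) + xi * T + c n.+1%:Z * xi ^+ (n + n).+2.
  rewrite {1}/trunc.
  have -> : (n.+1 + n.+1).+1 = (n + n).+3 by rewrite addnS addSn.
  rewrite big_ord_recr big_ord_recl/= expr0 mulr1 sub0r; congr (_ + _ + _ * _).
    rewrite /T /trunc mulr_sumr; apply: eq_bigr => i _.
    by rewrite /bump/= add1n exprS mulrCA; congr (_ * (c _ * _)); lia.
  by congr (c _); lia.
have : c n.+1%:Z * xi ^+ (n + n).+2 = trunc c n.+1 n.+1 xi - c (- n.+1%:Z) - xi * T.
  by rewrite E; ring.
move/(congr1 (fun z => normc z)); rewrite normcM normcX normc_expi expr1n mulr1 => ->.
apply: le_trans (ler_normcB _ _) _; rewrite normcM normc_expi mul1r.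
apply: le_trans (lerD (ler_normcB _ _) (lexx _)) _; have := cneg n; lra.
Qed.

End Coefficients.

Theorem theorem2 (R : realType) (omega : R -> R) (c : int -> R[i])
  (omega_pos : forall t : R, 0 < t -> 0 < omega t)
  (omega_incr : forall s t : R, 0 < s -> s <= t -> omega s / s <= omega t / t)
  (omega_sum : cvgn (series (fun n : nat => (omega n.+1%:R)^-1 : R)))
  (c_ae : {ae (@lebesgue_measure R), forall t : R, sym_sums_to_zero c t})
  (c_neg : exists (K : R) (n0 : nat), forall n : nat, (n0 <= n)%N -> (2 <= n)%N ->
      `|c (- (n%:Z))| <= (K * expR (- omega (ln n%:R)))%:C) :
  forall n : int, c n = 0.
Proof.
have [K [n0 hK]] := c_neg.
pose b := growth omega.
have b_gt0 k : 0 < b k := growth_gt0 omega_pos k.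
have b_mono k : b k <= b k.+1 := growth_mono omega_incr k.
have b_sum := growth_sum omega_pos omega_incr omega_sum.
(* A single term of the convergent sum of [1 / b k] is eventually at most [1 / 4]. *)
have [k1 hk1] : exists k1, forall k, (k1 <= k)%N -> 4 <= b k.
  have [|k1 h] := b_sum (1 / 4); first by rewrite divr_gt0.
  exists k1 => k k1k; have := h k k.+1 k1k; rewrite big_nat1.
  by rewrite div1r lef_pV2 ?posrE.
pose K' := Num.max K 1.
have K'1 : 1 <= K' by rewrite le_max lexx orbT.
have K'0 : 0 < K' := lt_le_trans ltr01 K'1.
pose kt := maxn k1 (maxn n0 (Num.truncn (ln K')).+1).
have tail k N : (kt <= k)%N -> neg_tail c (scale k) N <= expR (- 4 * gam b k).
  rewrite !geq_max => /and3P[k1k n0k Kk].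
  have b4 := hk1 k k1k.
  have t0 : 0 < 2 ^+ k :> R by rewrite exprn_gt0.
  have lnK' : ln K' <= 2 ^+ k.
    apply: le_trans (two_expn_ge R k).
    by apply: le_trans (ltW (truncnS_gt _)) _; rewrite ler_nat.
  (* With [2 ^ k <= ln n] and [b k >= 4], a quarter of [b k * ln n] covers
     [4 * gam b k = b k * 2 ^ k / 4]. The rest is at least [3 * ln n], which pays for [n ^ 2] and
     for the constant [K']. *)
  have hn n : (scale k < n)%N -> normc (c (- n%:Z)) <=
      expR (- 4 * gam b k) * (n%:R ^+ 2)^-1.
    move=> kn; have n2 : (2 <= n)%N by rewrite (leq_trans _ (ltnW kn))// (leq_trans _ (scale_ge4 k)).
    have n0n : (n0 <= n)%N.
      apply: (leq_trans n0k); apply: leq_trans (ltnW kn).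
      exact: leq_trans (ltnW (ltn_expl k (isT : (1 < 2)%N))) (ltnW (scale_gt k)).
    have nR : 0 < n%:R :> R by rewrite ltr0n (leq_trans _ n2).
    have := hK n n0n n2; rewrite ler_normcE => /le_trans; apply.
    apply: (@le_trans _ _ (K' * expR (- (b k * ln n%:R)))).
      apply: (@le_trans _ _ (K' * expR (- omega (ln n%:R)))).
        by rewrite ler_wpM2r ?expR_ge0// le_max lexx.
      rewrite ler_wpM2l ?(ltW K'0)// ler_expR lerN2.
      by apply: growth_decay => //; exact: ltnW.
    have ln2 := two_expn_le_ln R (ltnW kn).
    have -> : (n%:R ^+ 2)^-1 = expR (- (2 * ln n%:R)) :> R.
      by rewrite expRN expRM_natl lnK.
    rewrite -[K'](@lnK R) ?posrE// -!expRD ler_expR /gam.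
    by move: (2 ^+ k) (ln n%:R) (ln K') (b k) b4 t0 lnK' ln2 => t y x u *; nra.
  apply: (@le_trans _ _ (\sum_((scale k).+1 <= n < N.+1)
      expR (- 4 * gam b k) * (n%:R ^+ 2)^-1)).
    rewrite /neg_tail big_nat_cond [leRHS]big_nat_cond.
    by apply: ler_sum => n /andP[/andP[kn _] _]; exact: hn.
  rewrite -mulr_sumr -[leRHS]mulr1 ler_wpM2l ?expR_ge0//.
  by apply: sum_sqrV_le; rewrite (leq_trans _ (scale_ge4 k)).
pose C2 := neg_tail c 0 (scale kt) + 1.
have neg N : neg_tail c 0 N <= C2.
  have [Nk|kN] := leqP N (scale kt).
    apply: (@le_trans _ _ (neg_tail c 0 (scale kt))); last by rewrite lerDl.
    rewrite [leRHS]/neg_tail (@big_cat_nat _ _ _ N.+1)//= lerDl.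
    by apply: sumr_ge0 => i _; exact: normc_ge0.
  rewrite [leLHS]/neg_tail (@big_cat_nat _ _ _ (scale kt).+1) ?ltnS ?(ltnW kN)//=.
  rewrite lerD2l; apply: le_trans (tail kt N (leqnn _)) _.
  by rewrite -expR0 ler_expR mulNr oppr_le0 mulr_ge0// ltW// gam_gt0.
(* A null set cannot be the whole line. *)
have [t ht] : exists t, sym_sums_to_zero c t.
  apply: contrapT => /forallNP hno.
  case: c_ae => X [mX X0 hX].
  have XT : X = setT by apply/seteqP; split=> // t _; apply: hX => /=; exact: hno.
  have : lebesgue_measure (`[0, 1]%classic : set R) = 0%E.
    apply/eqP; rewrite eq_le measure_ge0 andbT -[leRHS]X0 le_measure ?inE//.
    by rewrite XT.
  by rewrite lebesgue_measure_itv/= lte_fin ltr01 oppr0 adde0 => /eqP; rewrite onee_eq0.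
have [Cc Cc1 c_bd] := coef_bounded neg ht.
exact: (coef_eq0 c_bd Cc1 neg tail b_mono b_gt0 (growth_le omega) b_sum c_ae).
Qed.
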